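(* Assume that $T>0$, $X_0=(u_0,v_0)^\top\in\mathbb H^1$ and $\mathbf Q^{\frac12}\in\mathcal L_2(L^2)$. Let $N,M\in\mathbb N^+$, $Mh=T$, $h\le \bar h_0$. Then the solution $(u^N_m,v^N_m)$ of the splitting averaged vector field scheme satisfies, for every $m\in\{0,1,\dots,M\}$, $$\mathbb E\big(V_1(u^N_m,v^N_m)\big)=V_1(u^N_0,v^N_0)+\tfrac12\mathrm{Tr}\Big((P_N\mathbf Q^{\frac12})(P_N\mathbf Q^{\frac12})^*\Big)t_m,$$ where $V_1(u^N_m,v^N_m)=\frac12\|u^N_m\|_{\dot{\mathbb H}^1}^2+\frac12\|v^N_m\|_{L^2}^2+F(u^N_m)+C_1$ with $C_1>b_1$.
   Context: Setting. $\mathcal O=(0,1)^d$ with $d\in\{1,2\}$, $L^p=L^p(\mathcal O;\mathbb R)$, and $\Lambda$ is the Laplacian on $\mathcal O$ with homogeneous Dirichlet boundary condition; $0<\lambda_1\le\lambda_2\le\cdots$ are the eigenvalues of $-\Lambda$ with eigenfunctions $\{e_i\}$ forming an orthonormal basis of $L^2$. $\dot{\mathbb H}^r=\mathcal D((-\Lambda)^{r/2})$ with $\|x\|_{\dot{\mathbb H}^r}^2=\sum_i\lambda_i^r\langle x,e_i\rangle_{L^2}^2$, $r\in\mathbb R$; $\mathbb H^r=\dot{\mathbb H}^r\times\dot{\mathbb H}^{r-1}$ with the product norm. $\mathcal L_2(L^2)$ denotes the Hilbert–Schmidt operators on $L^2$. $W$ is an $L^2$-valued $\mathbf Q$-Wiener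 process on a filtered probability space, where $\mathbf Q$ is a symmetric, positive definite operator of finite trace on $L^2$. $f(u)=c_3u^3+c_2u^2+c_1u+c_0$ with $c_3>0$ is a real polynomial. The initial data $u_0,v_0$ are deterministic. Potential. $F:L^4\to\mathbb R$ is a potential functional of $f$, i.e. $\frac{\partial F}{\partial u}(u)=f(u)$ (meaning $DF(u)w=\int_{\mathcal O}f(u)w\,dx$), chosen so that $a_1\|u\|_{L^4}^4-b_1\le F(u)\le a_2\|u\|_{L^4}^4+b_2$ for some positive constants $a_1,a_2,b_1,b_2$. Scheme. $P_N$ is the projection $P_N\zeta=\sum_{i=1}^N\langle\zeta,e_i\rangle_{L^2}e_i$ and $\Lambda_N=\Lambda P_N$. With $h=T/M$, $t_m=mh$, $u^N_0=P_Nu_0$, $v^N_0=P_Nv_0$, $\delta W_m=W(t_{m+1})-W(t_m)$, the splitting averaged vector field (AVF) scheme is, for $m=0,\dots,M-1$, $$u^N_{m+1}=u^N_m+h\tfrac{v^N_m+\bar v^N_{m+1}}2,\quad \bar v^N_{m+1}=v^N_m+h\Lambda_N\tfrac{u^N_m+u^N_{m+1}}2-hP_N\int_0^1f(u^N_m+\theta(u^N_{m+1}-u^N_m))d\theta,\quad v^N_{m+1}=\bar v^N_{m+1}+P_N\delta W_m.$$ Standing assumption: there is a sufficiently small $\bar h_0>0$, not depending on $N$, such that for step sizes $h\le\bar h_0$ the solution of this implicit scheme exists and is unique. *)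

(* Defs.v *)
From HB Require Import structures.
From mathcomp Require Import all_boot all_order all_algebra.
From mathcomp Require Import all_classical all_reals all_analysis.

Set Implicit Arguments.
Unset Strict Implicit.
Unset Printing Implicit Defensive.
Import Order.TTheory GRing.Theory Num.Theory.
Import numFieldNormedType.Exports.
Local Open Scope classical_set_scope.
Local Open Scope ring_scope.

(* R^d carries the sigma-algebra generated by its coordinates, as tuples do in
   the library; it is the Borel sigma-algebra. *)
Definition row_display : measure_display.
Proof. exact: measure_tuple_display default_measure_display. Qed.

Section measurable_row.
Context {R : realType} (d : nat).

Let coord (j : 'I_d) (x : 'rV[R]_d) : R := x ord0 j.

Let row_set0 : g_sigma_preimage coord set0.
Proof. exact: sigma_algebra0. Qed.

Let row_setC A : g_sigma_preimage coord A -> g_sigma_preimage coord (~` A).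
Proof. exact: sigma_algebraC. Qed.

Let row_bigcup (A : _^nat) : (forall i, g_sigma_preimage coord (A i)) ->
  g_sigma_preimage coord (\bigcup_i (A i)).
Proof. exact: sigma_algebra_bigcup. Qed.

HB.instance Definition _ := @isMeasurable.Build row_display
  'rV[R]_d (g_sigma_preimage coord) row_set0 row_setC row_bigcup.

Lemma measurable_coord (j : 'I_d) :
  measurable_fun setT (fun x : 'rV[R]_d => x ord0 j : R).
Proof.
move=> _ Y mY; rewrite setTI; apply: sub_sigma_algebra => /=.
rewrite -bigcup_seq/=; exists j => /=; first by rewrite mem_index_enum.
by exists Y => //; rewrite setTI.
Qed.

Lemma measurable_fun_rowP dT (T : measurableType dT) (f : T -> 'rV[R]_d) :
  (forall j, measurable_fun setT (fun t => f t ord0 j : R)) ->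
  measurable_fun setT f.
Proof.
move=> mf.
suff H : g_sigma_preimage (fun j => coord j \o f) `<=` measurable.
  move=> _ A mA; apply: H; rewrite g_sigma_preimage_comp; by exists A.
apply: smallest_sub; first exact: sigma_algebra_measurable.
rewrite -bigcup_seq/=; apply: bigcup_sub => j _ A [B mB <-]; exact: mf.
Qed.

End measurable_row.

Section cube.
Context (R : realType).

(* Lebesgue measure on (0,1). *)
Definition interval01 : set (measurableTypeR R) -> \bar R :=
  mrestr lebesgue_measure (measurable_itv `]0 : R, 1[).

HB.instance Definition _ := Measure.on interval01.

Let interval01_setT : interval01 setT = 1%E.
Proof.
by rewrite /interval01 /mrestr setTI lebesgue_measure_itv/= lte_fin ltr01 oppr0 adde0.
Qed.

HB.instance Definition _ :=
  Measure_isProbability.Build _ _ _ interval01 interval01_setT.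

Definition cons_row d (p : measurableTypeR R * 'rV[R]_d) : 'rV[R]_(1 + d) :=
  row_mx (\row_(_ < 1) (p.1 : R)) p.2.

Let measurable_cons_row d : measurable_fun setT (@cons_row d).
Proof.
apply: measurable_fun_rowP => j; rewrite /cons_row.
under eq_fun do rewrite mxE.
case: (fintype.split j) => k.
  by under eq_fun do rewrite mxE; exact: measurable_fst.
exact: (measurableT_comp (measurable_coord k)).
Qed.

HB.instance Definition _ d := isMeasurableFun.Build _ _ _ _ (@cons_row d)
  (@measurable_cons_row d).

(* Lebesgue measure on (0,1)^d, as a measure on R^d, by iterated products. *)
Fixpoint cubeL d : probability 'rV[R]_d R :=
  if d is k.+1 then
    distribution (interval01 \x cubeL k)%E (@cons_row k)
  else @dirac _ 'rV[R]_0 (0 : 'rV[R]_0) R.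

Definition cube d : set 'rV[R]_d :=
  [set x | forall j, 0 < x ord0 j < 1].

End cube.
Arguments cube : clear implicits.

(* Elements of L^p((0,1)^d) are represented by functions R^d -> R in the
   library's [Lfun]; equality in L^p is almost everywhere equality for
   [cubeL R d].  Operators on L^2 and functionals on L^4 act on representatives;
   boundedness (resp. differentiability) makes them well defined on classes. *)
Section function_spaces.
Context {R : realType} {d : nat}.
Local Notation mu := (cubeL R d).
Local Notation fn := ('rV[R]_d -> R).
Implicit Types (x y g u v w : fn) (A B Q S : fn -> fn).

Definition inL (p : R) x : Prop := x \in Lfun mu p%:E.

Definition normL (p : R) x : R := fine ('N[mu]_(p%:E)[EFin \o x]).

Definition inner x y : R := \int[mu]_z (x z * y z).

Definition bounded_operator A : Prop :=
  [/\ forall x, inL 2 x -> inL 2 (A x),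
      forall (a : R) x y, inL 2 x -> inL 2 y ->
        A (fun z => a * x z + y z) = (fun z => a * A x z + A y z) %[ae mu] &
      exists C : R, forall x, inL 2 x -> normL 2 (A x) <= C * normL 2 x].

Definition symmetric_operator A : Prop :=
  forall x y, inL 2 x -> inL 2 y -> inner (A x) y = inner x (A y).

Definition positive_definite A : Prop :=
  forall x, inL 2 x -> ~ x = cst 0 %[ae mu] -> 0 < inner (A x) x.

Definition nonneg_operator A : Prop :=
  forall x, inL 2 x -> 0 <= inner (A x) x.

(* [S] is the (unique) nonnegative square root of [Q]. *)
Definition is_sqrt_operator Q S : Prop :=
  [/\ bounded_operator S, symmetric_operator S, nonneg_operator S &
      forall x, inL 2 x -> S (S x) = Q x %[ae mu]].

Definition is_adjoint A B : Prop :=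
  bounded_operator B /\
  forall x y, inL 2 x -> inL 2 y -> inner (A x) y = inner x (B y).

Definition adjoint A : fn -> fn := xget (fun x : fn => x) [set B | is_adjoint A B].

Definition partial (j : 'I_d) g : fn := 'D_(delta_mx ord0 j) g.

Definition laplacian g : fn := fun z => \sum_(j < d) partial j (partial j g) z.

(* Functions of class C^2 on the open cube, continuous on the closed cube and
   vanishing on its boundary. *)
Definition dirichlet_domain g : Prop :=
  [/\ forall z, cube R d z -> forall i j : 'I_d,
        [/\ derivable g z (delta_mx ord0 i),
            {for z, continuous (partial i g)},
            derivable (partial i g) z (delta_mx ord0 j) &
            {for z, continuous (partial j (partial i g))}],
      {within closure (cube R d), continuous g} &
      forall z, (closure (cube R d) `\` cube R d) z -> g z = 0].

(* An L^2-orthonormal basis of eigenfunctions, each given by its classical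
   representative.  Indices start at 0: [lam i] and [e i] are the eigenvalue and
   eigenfunction of index i + 1. *)
Definition dirichlet_eigenbasis (lam : nat -> R) (e : nat -> fn) : Prop :=
  [/\ 0 < lam 0%N /\ (forall i, lam i <= lam i.+1),
      forall i, dirichlet_domain (e i) /\
        forall z, cube R d z -> - laplacian (e i) z = lam i * e i z,
      forall i, inL 2 (e i),
      forall i j, inner (e i) (e j) = (i == j)%:R &
      forall x, inL 2 x ->
        normL 2 (fun z => x z - \sum_(i < n) inner x (e i) * e i z)
          @[n --> \oo] --> (0 : R)].

Section spectral.
Variables (lam : nat -> R) (e : nat -> fn).

Definition trace A : R :=
  limn (series (fun i => inner (A (e i)) (e i))).

(* For nonnegative symmetric operators. *)
Definition finite_trace A : Prop :=
  cvgn (series (fun i => inner (A (e i)) (e i))).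

Definition hilbert_schmidt A : Prop :=
  bounded_operator A /\ cvgn (series (fun i => normL 2 (A (e i)) ^+ 2)).

(* The spaces D((-Lambda)^(r/2)) for r >= 0, as subspaces of L^2. *)
Definition in_Hdot (r : R) x : Prop :=
  inL 2 x /\ cvgn (series (fun i => lam i `^ r * inner x (e i) ^+ 2)).

Definition norm_Hdot (r : R) x : R :=
  Num.sqrt (limn (series (fun i => lam i `^ r * inner x (e i) ^+ 2))).

Definition projN (N : nat) x : fn :=
  fun z => \sum_(i < N) inner x (e i) * e i z.

Definition inVN (N : nat) x : Prop := inL 2 x /\ x = projN N x %[ae mu].

(* [projN N x] is a linear combination of the smooth functions [e i], so that
   Lambda P_N is the classical Laplacian applied to it. *)
Definition LambdaN (N : nat) x : fn := laplacian (projN N x).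

End spectral.

(* [F] has Frechet derivative w |-> \int f(u) w at every u of L^4. *)
Definition potential (f : R -> R) (F : fn -> R) : Prop :=
  forall u, inL 4 u -> forall eps : R, 0 < eps ->
    exists2 del : R, 0 < del & forall w, inL 4 w -> normL 4 w <= del ->
      `|F (fun z => u z + w z) - F u - \int[mu]_z (f (u z) * w z)|
        <= eps * normL 4 w.

(* Open subsets of L^2, and its Borel sigma-algebra. *)
Definition openL2 (U : set fn) : Prop :=
  U `<=` inL 2 /\
  forall x, U x -> exists2 r : R, 0 < r &
    forall y, inL 2 y -> normL 2 (fun z => y z - x z) < r -> U y.

Definition borelL2 : set (set fn) := <<s inL 2, openL2 >>.

End function_spaces.

Definition cubic {R : realType} (c3 c2 c1 c0 u : R) : R :=
  c3 * u ^+ 3 + c2 * u ^+ 2 + c1 * u + c0.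

Section stochastic.
Context {R : realType} {dO : measure_display} {Omega : measurableType dO}.
Variable P : probability Omega R.

(* The time index ranges over the nonnegative reals. *)
Definition filtration (Ft : R -> set (set Omega)) : Prop :=
  [/\ forall t, 0 <= t -> sigma_algebra setT (Ft t),
      forall t, 0 <= t -> Ft t `<=` measurable &
      forall s t, 0 <= s -> s <= t -> Ft s `<=` Ft t].

(* X has the law N(m, s2); [normal_prob] does not cover the case s2 = 0. *)
Definition gaussian (X : Omega -> R) (m s2 : R) : Prop :=
  forall A : set R, measurable A ->
    P (X @^-1` A) =
      if s2 == 0 then \d_m A else normal_prob m (Num.sqrt s2) A.

Record Q_wiener {d} (Ft : R -> set (set Omega))
    (Q : ('rV[R]_d -> R) -> 'rV[R]_d -> R)
    (W : R -> Omega -> 'rV[R]_d -> R) : Prop := {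
  wiener_L2 : forall t w, 0 <= t -> inL 2 (W t w);
  wiener_0 : {ae P, forall w, W 0 w = cst 0 %[ae cubeL R d]};
  wiener_continuous : {ae P, forall w, forall t, 0 <= t ->
    forall eps : R, 0 < eps -> exists2 del : R, 0 < del &
    forall s, 0 <= s -> `|s - t| < del ->
      normL 2 (fun z => W s w z - W t w z) < eps};
  wiener_adapted : forall t, 0 <= t -> forall B, borelL2 B ->
    Ft t (W t @^-1` B);
  wiener_independent : forall s t, 0 <= s -> s <= t ->
    forall A B, Ft s A -> borelL2 B ->
      let X := (fun w z => W t w z - W s w z) @^-1` B in
      P (A `&` X) = (P A * P X)%E;
  wiener_gaussian : forall s t, 0 <= s -> s <= t ->
    forall x : 'rV[R]_d -> R, inL 2 x ->
      gaussian (fun w => inner (fun z => W t w z - W s w z) x)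
               0 ((t - s) * inner (Q x) x) }.

End stochastic.

Section scheme.
Context {R : realType} {d : nat}.
Local Notation mu := (cubeL R d).
Local Notation fn := ('rV[R]_d -> R).
Variables (e : nat -> fn) (f : R -> R).

(* The implicit part (u, v) |-> (u1, vbar) of the scheme. *)
Definition avf_step (N : nat) (h : R) (u v u1 vbar : fn) : Prop :=
  [/\ inL 2 u1, inL 2 vbar,
      u1 = (fun z => u z + h * ((v z + vbar z) / 2)) %[ae mu] &
      vbar = (fun z => v z
        + h * LambdaN e N (fun y => (u y + u1 y) / 2) z
        - h * projN e N (fun y =>
            \int[lebesgue_measure]_(theta in `[0, 1])
              f (u y + theta * (u1 y - u y))) z) %[ae mu]].

(* For step sizes h <= hbar the implicit scheme is uniquely solvable; hbar
   does not depend on N. *)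
Definition avf_solvable (hbar : R) : Prop :=
  forall (N : nat) (h : R) (u v : fn), (0 < N)%N -> 0 < h -> h <= hbar ->
    inVN e N u -> inVN e N v ->
    exists u1 vbar : fn, avf_step N h u v u1 vbar /\
      forall u1' vbar' : fn, avf_step N h u v u1' vbar' ->
        u1' = u1 %[ae mu] /\ vbar' = vbar %[ae mu].

Definition avf_solution {Omega : Type} (N M : nat) (h : R)
    (W : R -> Omega -> fn) (u0 v0 : fn) (u v vbar : nat -> Omega -> fn) : Prop :=
  forall w : Omega,
  [/\ forall m, (m <= M)%N -> inL 2 (u m w) /\ inL 2 (v m w),
      u 0%N w = projN e N u0 %[ae mu],
      v 0%N w = projN e N v0 %[ae mu] &
      forall m, (m < M)%N ->
        avf_step N h (u m w) (v m w) (u m.+1 w) (vbar m.+1 w) /\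
        v m.+1 w = (fun z => vbar m.+1 w z
          + projN e N (fun y => W (m.+1%:R * h) w y - W (m%:R * h) w y) z)
          %[ae mu]].

End scheme.

Definition V1 {R : realType} {d : nat} (lam : nat -> R)
    (e : nat -> 'rV[R]_d -> R) (F : ('rV[R]_d -> R) -> R) (C1 : R)
    (u v : 'rV[R]_d -> R) : R :=
  2^-1 * norm_Hdot lam e 1 u ^+ 2 + 2^-1 * normL 2 v ^+ 2 + F u + C1.

(* Main.v *)
Require Import Defs.
From HB Require Import structures.
From mathcomp Require Import all_boot all_order all_algebra.
From mathcomp Require Import all_classical all_reals all_analysis.
From mathcomp Require Import measurable_realfun ess_sup_inf ring lra.
Set Implicit Arguments.
Unset Strict Implicit.
Unset Printing Implicit Defensive.
Import Order.TTheory GRing.Theory Num.Theory.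
Import numFieldNormedType.Exports.
Local Open Scope classical_set_scope.
Local Open Scope ring_scope.

(** Everything happens in the span of the first [N] eigenfunctions: a state of
    the scheme is almost everywhere a combination of them, so it is a pair
    [(p, q)] of coordinate vectors, and one step of the scheme is a polynomial
    system in these coordinates followed by the addition of the coordinates of
    the noise increment.

    Energy.  A potential of a cubic [f] is, up to an additive constant, the
    integral of the primitive of [f] ([potentialE]), and the averaged vector
    field is the divided difference of that primitive.  The increment of [F]
    over a step is therefore the work of the averaged force
    ([potential_increment]), and the deterministic part of the step conserves
    [V1] exactly ([avf_energy]).  The noise changes the velocity coordinates
    [qb] into [qb + Y], so that [V1] increases by
    [\sum_i (qb_i * Y_i + Y_i ^+ 2 / 2)].

    Probability.  [Y_i] is centred Gaussian with variance
    [h * inner (Q (e i)) (e i)] and independent of the past, hence the cross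
    terms have mean zero as soon as [qb_i] is measurable with respect to the
    past ([increment_orthogonal]), and the squares contribute
    [h / 2 * \sum_i inner (Q (e i)) (e i)], which is [h / 2] times the trace in
    the theorem ([trace_projection]).  Integrability propagates along the
    steps since conservation of energy bounds [qb_i ^+ 2] by twice the energy
    before the step ([qb_sqr_le]).

    Measurability of the implicit step.  The new position is the only zero of a
    defect that is continuous in the unknown and measurable in the data; such a
    zero is a measurable function of the data ([measurable_unique_zero]), by
    compactness and approximation with rational points. *)

(** * Lebesgue measure on the cube *)

Section cube_measure.
Context {R : realType}.

Lemma measurable_cube d : measurable (cube R d).
Proof.
rewrite (_ : cube R d = \bigcap_(j in [set: 'I_d])
    ((fun x : 'rV[R]_d => x ord0 j) @^-1` `]0 : R, 1[)); last first.
  by apply/seteqP; split => x /= H j => [_|]; move: (H j); rewrite /= in_itv/= => // ->.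
apply: fin_bigcap_measurable => // j _.
rewrite -[X in measurable X]setTI.
exact: measurable_coord.
Qed.

Lemma cubeL_cube d : cubeL R d (cube R d) = 1%E.
Proof.
elim: d => [|d IH] /=.
  rewrite diracE mem_set//= => -[] //.
rewrite /pushforward.
rewrite (_ : _ @^-1` _ = `]0 : R, 1[%classic `*` cube R d); last first.
  apply/seteqP; split => -[a x] /=.
    move=> H0; have H : cube R (1 + d) (cons_row (a, x)) by []; split.
      by have := H (lshift d (ord0 : 'I_1)); rewrite /cons_row row_mxEl mxE in_itv.
    by move=> j; have := H (rshift 1 j); rewrite /cons_row row_mxEr.
  move=> [ha hx]; change (cube R (1 + d) (cons_row (a, x))) => j; rewrite /cons_row.
  case: (split_ordP j) => k ->; first by rewrite row_mxEl mxE; rewrite /= in_itv in ha.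
  by rewrite row_mxEr; exact: hx.
rewrite product_measure1E//=; last exact: measurable_cube.
rewrite [cubeL R d _]IH mule1.
by rewrite /interval01 /mrestr setIid lebesgue_measure_itv/= lte_fin ltr01 oppr0 adde0.
Qed.

Lemma ae_cube d : {ae cubeL R d, forall z, cube R d z}.
Proof.
exists (~` cube R d); split => //; first by apply: measurableC; exact: measurable_cube.
by rewrite probability_setC ?cubeL_cube ?subee//; exact: measurable_cube.
Qed.

End cube_measure.

(** * Bounded functions and the inner product of L^2 *)

Section essentially_bounded.
Context {R : realType} {d : nat}.
Local Notation mu := (cubeL R d).
Local Notation fn := ('rV[R]_d -> R).
Implicit Types (a b x y : fn).

(** Unlike L^2, this class is stable under products, and it contains the
    eigenfunctions: all the nonlinear expressions of the scheme are integrable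
    because they stay in it. *)
Definition essbdd b : Prop :=
  measurable_fun setT b /\ exists M : R, {ae mu, forall z, `|b z| <= M}.

Lemma essbdd_cst (c : R) : essbdd (fun=> c).
Proof. by split=> //; exists `|c|; apply: aeW. Qed.

Lemma essbddD a b : essbdd a -> essbdd b -> essbdd (fun z => a z + b z).
Proof.
move=> [ma [A hA]] [mb [B hB]]; split; first exact: measurable_funD.
exists (A + B); apply: filterS2 hA hB => z az bz.
by rewrite (le_trans (ler_normD _ _))// lerD.
Qed.

Lemma essbddM a b : essbdd a -> essbdd b -> essbdd (fun z => a z * b z).
Proof.
move=> [ma [A hA]] [mb [B hB]]; split; first exact: measurable_funM.
exists (A * B); apply: filterS2 hA hB => z az bz.
by rewrite normrM ler_pM.
Qed.

Lemma essbddZ (c : R) b : essbdd b -> essbdd (fun z => c * b z).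
Proof. by move=> hb; apply: essbddM => //; exact: essbdd_cst. Qed.

Lemma essbddX b n : essbdd b -> essbdd (fun z => b z ^+ n).
Proof.
move=> hb; elim: n => [|n IH].
  by under eq_fun do rewrite expr0; exact: essbdd_cst.
by under eq_fun do rewrite exprS; exact: essbddM.
Qed.

Lemma essbdd_sum n (b : 'I_n -> fn) : (forall i, essbdd (b i)) ->
  essbdd (fun z => \sum_(i < n) b i z).
Proof.
move=> hb; elim: n b hb => [|n IH] b hb.
  by under eq_fun do rewrite big_ord0; exact: essbdd_cst.
under eq_fun do rewrite big_ord_recl.
by apply: essbddD => //; apply: IH.
Qed.

Lemma essbdd_inL (p : R) b : 1 <= p -> essbdd b -> inL p b.
Proof.
move=> p1 [mb [M hM]].
apply: (@Lfun_subset _ _ _ mu p%:E +oo%E) => //.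
- by rewrite leey.
- by rewrite fin_num_measure.
- by rewrite leey.
rewrite inE; apply/andP; split; rewrite inE//= /finite_norm unlock /Lnorm.
case: ifPn => // _; apply: (@le_lt_trans _ _ M%:E); last exact: ltry.
by apply/ess_supP; apply: filterS hM => z; rewrite /= lee_fin.
Qed.

Lemma essbdd_integrable b : essbdd b -> mu.-integrable setT (EFin \o b).
Proof. by move=> hb; apply/Lfun1_integrable; apply: (@essbdd_inL 1). Qed.

End essentially_bounded.

Section inner_product.
Context {R : realType} {d : nat}.
Local Notation mu := (cubeL R d).
Local Notation fn := ('rV[R]_d -> R).
Implicit Types (a b x y : fn).

Let one_le2 : (1 <= 2%:E :> \bar R)%E. Proof. by rewrite lee1n. Qed.

Lemma inL_measurable (p : R) x : inL p x -> measurable_fun setT x.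
Proof. by rewrite /inL inE => /andP[+ _]; rewrite inE. Qed.

Lemma inL2_lin (c : R) x y : inL 2 x -> inL 2 y -> inL 2 (fun z => c * x z + y z).
Proof. by move=> hx hy; have [_] := Lfun_submod_closed mu one_le2; exact. Qed.

Lemma inL2D x y : inL 2 x -> inL 2 y -> inL 2 (fun z => x z + y z).
Proof. by move=> hx hy; have := inL2_lin 1 hx hy; under eq_fun do rewrite mul1r. Qed.

Lemma inL2_0 : inL 2 ((fun=> 0) : fn).
Proof. by apply: essbdd_inL; [rewrite ler1n|exact: essbdd_cst]. Qed.

Lemma inL2Z (c : R) x : inL 2 x -> inL 2 (fun z => c * x z).
Proof. by move=> hx; have := inL2_lin c hx inL2_0; under eq_fun do rewrite addr0. Qed.

Lemma inL2B x y : inL 2 x -> inL 2 y -> inL 2 (fun z => x z - y z).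
Proof.
by move=> hx hy; have := inL2_lin (-1) hy hx; under eq_fun do rewrite mulN1r addrC.
Qed.

Lemma inL2_sum n (x : 'I_n -> fn) : (forall i, inL 2 (x i)) ->
  inL 2 (fun z => \sum_(i < n) x i z).
Proof.
elim: n x => [|n IH] x hx.
  by under eq_fun do rewrite big_ord0; exact: inL2_0.
under eq_fun do rewrite big_ord_recl.
by apply: inL2D => //; apply: IH.
Qed.

Lemma inL2_integrableM x y : inL 2 x -> inL 2 y ->
  mu.-integrable setT (EFin \o (fun z => x z * y z)).
Proof. by move=> hx hy; apply/Lfun1_integrable; exact: Lfun2_mul_Lfun1. Qed.

Lemma innerC x y : inner x y = inner y x.
Proof. by rewrite /inner; apply: eq_Rintegral => z _; rewrite mulrC. Qed.

Lemma innerDl x y w : inL 2 x -> inL 2 y -> inL 2 w ->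
  inner (fun z => x z + y z) w = inner x w + inner y w.
Proof.
move=> hx hy hw; rewrite /inner -RintegralD//; try exact: inL2_integrableM.
by apply: eq_Rintegral => z _; rewrite mulrDl.
Qed.

Lemma innerZl (c : R) x w : inL 2 x -> inL 2 w ->
  inner (fun z => c * x z) w = c * inner x w.
Proof.
move=> hx hw; rewrite /inner -RintegralZl//; last exact: inL2_integrableM.
by apply: eq_Rintegral => z _; rewrite mulrA.
Qed.

Lemma innerBl x y w : inL 2 x -> inL 2 y -> inL 2 w ->
  inner (fun z => x z - y z) w = inner x w - inner y w.
Proof.
move=> hx hy hw; rewrite /inner -RintegralB//; try exact: inL2_integrableM.
by apply: eq_Rintegral => z _; rewrite mulrBl.
Qed.

Lemma inner_suml n (c : 'I_n -> R) (x : 'I_n -> fn) w :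
  (forall i, inL 2 (x i)) -> inL 2 w ->
  inner (fun z => \sum_(i < n) c i * x i z) w = \sum_(i < n) c i * inner (x i) w.
Proof.
move=> hx hw; elim: n c x hx => [|n IH] c x hx.
  rewrite big_ord0 /inner; under eq_Rintegral do rewrite big_ord0 mul0r.
  by rewrite /Rintegral integral0.
under [X in inner X _]eq_fun do rewrite big_ord_recl.
rewrite innerDl//; [|exact: inL2Z|]; last first.
  by apply: inL2_sum => i; exact: inL2Z.
by rewrite innerZl// big_ord_recl IH.
Qed.

Lemma Rintegral_ae (f g : fn) : measurable_fun setT f -> measurable_fun setT g ->
  f = g %[ae mu] -> \int[mu]_z f z = \int[mu]_z g z.
Proof.
move=> mf mg fg; congr fine; apply: ae_eq_integral => //.
- exact/measurable_EFinP.
- exact/measurable_EFinP.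
- by apply: filterS fg => z /= /[apply] ->.
Qed.

Lemma inner_ae x x' y : measurable_fun setT x -> measurable_fun setT x' ->
  measurable_fun setT y -> x = x' %[ae mu] -> inner x y = inner x' y.
Proof.
move=> mx mx' my xx'; apply: Rintegral_ae; try exact: measurable_funM.
by apply: filterS xx' => z /= /[apply] ->.
Qed.

Lemma normL2_sqr x : inL 2 x -> normL 2 x ^+ 2 = inner x x.
Proof.
move=> hx; rewrite /normL.
have fin : ('N[mu]_2%:E[EFin \o x] \is a fin_num)%E.
  rewrite ge0_fin_numE ?Lnorm_ge0//.
  by move: hx; rewrite /inL inE => /andP[_]; rewrite inE.
rewrite /inner /Rintegral -powR_mulrn ?fine_ge0 ?Lnorm_ge0//.
apply: EFin_inj; rewrite -poweR_EFin fineK// powR_Lnorm ?pnatr_eq0// fineK; last first.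
  exact: (integrable_fin_num measurableT (inL2_integrableM hx hx)).
apply: eq_integral => z _ /=; rewrite powR_mulrn//.
by rewrite -normrX ger0_norm ?sqr_ge0 ?expr2.
Qed.

Lemma normL_ge0 (p : R) x : 0 <= normL p x.
Proof. by rewrite fine_ge0 ?Lnorm_ge0. Qed.

Lemma cauchy_schwarz x y : inL 2 x -> inL 2 y -> `|inner x y| <= normL 2 x * normL 2 y.
Proof.
move=> hx hy.
have fin w : inL 2 w -> ('N[mu]_2%:E[EFin \o w] \is a fin_num)%E.
  move=> hw; rewrite ge0_fin_numE ?Lnorm_ge0//.
  by move: hw; rewrite /inL inE => /andP[_]; rewrite inE.
apply: le_trans (le_normr_Rintegral _ _) _ => //; first exact: inL2_integrableM.
rewrite -lee_fin EFinM !fineK ?fin//; last first.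
  have := integrable_norm (inL2_integrableM hx hy).
  exact: integrable_fin_num.
have := @hoelder _ _ _ mu x y 2 2 (inL_measurable hx) (inL_measurable hy).
rewrite !ltr0n => /(_ isT isT); rewrite Lnorm1/=; apply.
by rewrite [RHS]splitr !div1r.
Qed.

End inner_product.

(** * Eigenfunctions and the space they span *)

Section classical_functions.
Context {R : realType} {d : nat}.
Local Notation fn := ('rV[R]_d -> R).

Lemma cube_ball : cube R d = ball (const_mx 2^-1 : 'rV[R]_d) 2^-1.
Proof.
apply/seteqP; split => z.
  move=> hz; split => [|i j]; first by rewrite invr_gt0.
  rewrite mxE /ball/= (ord1 i); have := hz j.
  by move=> /andP[z0 z1]; rewrite ltr_norml; apply/andP; split; lra.
move=> [_ hz] j; have := hz ord0 j; rewrite mxE /ball/= ltr_norml.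
by move=> /andP[z0 z1]; apply/andP; split; lra.
Qed.

Lemma open_cube : open (cube R d).
Proof. by rewrite cube_ball; exact: ball_open. Qed.

Lemma compact_closure_cube : compact (closure (cube R d)).
Proof.
pose K := [set z : 'rV[R]_d | forall j, `[0 : R, 1]%classic (z ord0 j)].
have cK : compact K.
  by apply: (@rV_compact _ _ (fun=> `[0 : R, 1]%classic)) => _; exact: segment_compact.
apply: subclosed_compact (cK) _; first exact: closed_closure.
have clK : closed K by apply: compact_closed cK; apply: (@norm_hausdorff R).
rewrite [X in _ `<=` X](iffLR (closure_id K) clK); apply: closure_subset => z hz j /=.
by have /andP[/ltW z0 /ltW z1] := hz j; rewrite in_itv/= z0 z1.
Qed.

(** Continuity on the compact closure of the cube gives a bound there, and
    nothing is known outside, which is negligible. *)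
Lemma dirichlet_domain_essbdd (g : fn) : dirichlet_domain g ->
  measurable_fun setT g -> essbdd g.
Proof.
move=> [_ cg _] mg; split => //.
have := compact_bounded (continuous_compact cg compact_closure_cube).
move=> [M [_ hM]]; exists (M + 1); apply: filterS (ae_cube d) => z hz.
by apply: hM; [rewrite ltrDl|exists z => //; exact: subset_closure].
Qed.

Lemma partial_sum n (c : 'I_n -> R) (g : 'I_n -> fn) (j : 'I_d) z :
  (forall i, derivable (g i) z (delta_mx ord0 j)) ->
  partial j (fun y => \sum_(i < n) c i * g i y) z =
  \sum_(i < n) c i * partial j (g i) z.
Proof.
move=> dg; rewrite /partial.
rewrite (_ : (fun y => _) = \sum_(i < n) (c i \*: g i)); last first.
  by apply/funext => y; rewrite fct_sumE.
rewrite derive_sum; last by move=> i; exact: derivableZ.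
by apply: eq_bigr => i _; rewrite deriveZ.
Qed.

(** The inner derivative is computed at the points of the cube only; since the
    cube is open this determines the outer derivative there. *)
Lemma laplacian_sum n (c : 'I_n -> R) (g : 'I_n -> fn) z :
  (forall i, dirichlet_domain (g i)) -> cube R d z ->
  laplacian (fun y => \sum_(i < n) c i * g i y) z =
  \sum_(i < n) c i * laplacian (g i) z.
Proof.
move=> hg hz; rewrite /laplacian.
under [RHS]eq_bigr do rewrite mulr_sumr.
rewrite exchange_big/=; apply: eq_bigr => j _.
have -> : partial j (partial j (fun y => \sum_(i < n) c i * g i y)) z =
          partial j (fun y => \sum_(i < n) c i * partial j (g i) y) z.
  apply: near_eq_derive.
  have : nbhs z (cube R d) by apply: open_nbhs_nbhs; split => //; exact: open_cube.
  apply: filterS => y hy; apply: partial_sum => i.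
  by have [/(_ _ hy j j)[]] := hg i.
by rewrite partial_sum// => i; have [/(_ _ hz j j)[]] := hg i.
Qed.

End classical_functions.

Lemma limn_series_finite {R : realType} (N : nat) (a : nat -> R) :
  (forall i, (N <= i)%N -> a i = 0) -> limn (series a) = \sum_(i < N) a i.
Proof.
move=> a0; apply: cvg_lim => //.
apply: (@cvg_trans _ (cst (\sum_(i < N) a i) @ \oo)); last exact: cvg_cst.
apply: near_eq_cvg; near=> n; rewrite /series/=.
have Nn : (N <= n)%N by near: n; exact: nbhs_infty_ge.
rewrite (big_cat_nat (leq0n N) Nn)/= [X in _ = _ + X]big_nat_cond.
rewrite [X in _ = _ + X]big1 => [|i /andP[/andP[Ni _] _]]; last exact: a0.
by rewrite addr0 big_mkord.
Unshelve. all: by end_near. Qed.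

Definition comb {R : realType} {d : nat} (e : nat -> 'rV[R]_d -> R) {N : nat}
    (p : 'rV[R]_N) : 'rV[R]_d -> R :=
  fun z => \sum_(i < N) p ord0 i * e i z.

Definition coords {R : realType} {d : nat} (e : nat -> 'rV[R]_d -> R) (N : nat)
    (x : 'rV[R]_d -> R) : 'rV[R]_N :=
  \row_(i < N) inner x (e i).

Section eigenbasis.
Context {R : realType} {d : nat} {lam : nat -> R} {e : nat -> 'rV[R]_d -> R}.
Local Notation mu := (cubeL R d).
Local Notation fn := ('rV[R]_d -> R).
Hypothesis he : dirichlet_eigenbasis lam e.
Implicit Types x y : fn.

Lemma eigen_inL i : inL 2 (e i). Proof. by have [_ _] := he. Qed.
Hint Resolve eigen_inL : core.

Lemma eigen_inner i j : inner (e i) (e j) = (i == j)%:R.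
Proof. by have [_ _ _ + _] := he; exact. Qed.

Lemma eigenvalue_gt0 i : 0 < lam i.
Proof.
have [[h0 hS] _ _ _ _] := he.
by elim: i => [//|i IH]; exact: lt_le_trans IH (hS i).
Qed.

Lemma eigen_essbdd i : essbdd (e i).
Proof.
have [_ /(_ i)[hd _] _ _ _] := he.
by apply: dirichlet_domain_essbdd => //; exact: inL_measurable (eigen_inL i).
Qed.

Lemma comb_essbdd N (p : 'rV[R]_N) : essbdd (comb e p).
Proof. by apply: essbdd_sum => i; apply: essbddZ; exact: eigen_essbdd. Qed.

Lemma comb_inL N (p : 'rV[R]_N) : inL 2 (comb e p).
Proof. by apply: essbdd_inL; [rewrite ler1n|exact: comb_essbdd]. Qed.
Hint Resolve comb_inL : core.

Lemma projN_comb N x : projN e N x = comb e (coords e N x).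
Proof. by apply/funext => z; rewrite /projN /comb; under [RHS]eq_bigr do rewrite mxE. Qed.

Lemma inner_comb N (p : 'rV[R]_N) x : inL 2 x ->
  inner (comb e p) x = \sum_(i < N) p ord0 i * inner (e i) x.
Proof. by move=> hx; rewrite /comb inner_suml. Qed.

Lemma inner_comb_eigen N (p : 'rV[R]_N) k :
  inner (comb e p) (e k) = \sum_(i < N) p ord0 i * (i == k :> nat)%:R.
Proof. by rewrite inner_comb//; apply: eq_bigr => i _; rewrite eigen_inner. Qed.

Lemma inner_comb_lt N (p : 'rV[R]_N) (i : 'I_N) : inner (comb e p) (e i) = p ord0 i.
Proof.
rewrite inner_comb_eigen (bigD1 i)//= eqxx mulr1 big1 ?addr0// => j ji.
by rewrite (negbTE (ji : (j : nat) != i)) mulr0.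
Qed.

Lemma inner_comb_ge N (p : 'rV[R]_N) k : (N <= k)%N -> inner (comb e p) (e k) = 0.
Proof.
move=> Nk; rewrite inner_comb_eigen big1// => j _.
by rewrite ltn_eqF ?mulr0// (leq_trans (ltn_ord j)).
Qed.

Lemma coords_comb N (p : 'rV[R]_N) : coords e N (comb e p) = p.
Proof. by apply/rowP => i; rewrite mxE inner_comb_lt. Qed.

Lemma coords_ae N x y : inL 2 x -> inL 2 y -> x = y %[ae mu] ->
  coords e N x = coords e N y.
Proof.
move=> hx hy xy; apply/rowP => i; rewrite !mxE.
by apply: inner_ae => //; apply: inL_measurable; eassumption || exact: eigen_inL.
Qed.

Lemma inner_comb2 N (p q : 'rV[R]_N) :
  inner (comb e p) (comb e q) = \sum_(i < N) p ord0 i * q ord0 i.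
Proof.
by rewrite inner_comb//; apply: eq_bigr => i _; rewrite innerC inner_comb_lt.
Qed.

Lemma normL2_comb N (p : 'rV[R]_N) :
  normL 2 (comb e p) ^+ 2 = \sum_(i < N) p ord0 i ^+ 2.
Proof. by rewrite normL2_sqr// inner_comb2; apply: eq_bigr => i _; rewrite expr2. Qed.

Lemma norm_Hdot_comb N (p : 'rV[R]_N) :
  norm_Hdot lam e 1 (comb e p) ^+ 2 = \sum_(i < N) lam i * p ord0 i ^+ 2.
Proof.
rewrite /norm_Hdot (@limn_series_finite _ N) => [|i Ni]; last first.
  by rewrite inner_comb_ge// expr0n mulr0.
have -> : \sum_(i < N) lam i `^ 1 * inner (comb e p) (e i) ^+ 2 =
          \sum_(i < N) lam i * p ord0 i ^+ 2.
  by apply: eq_bigr => i _; rewrite inner_comb_lt powRr1// ltW// eigenvalue_gt0.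
rewrite sqr_sqrtr//; apply: sumr_ge0 => i _.
by rewrite mulr_ge0 ?sqr_ge0// ltW// eigenvalue_gt0.
Qed.

Lemma LambdaN_coords N x :
  LambdaN e N x = comb e (\row_(i < N) (- lam i * inner x (e i))) %[ae mu].
Proof.
apply: filterS (ae_cube d) => z hz _.
have [_ hdom _ _ _] := he.
rewrite /LambdaN /projN laplacian_sum//; last by move=> k; have [] := hdom k.
rewrite /comb; apply: eq_bigr => k _; rewrite mxE.
have [_ /(_ z hz)] := hdom k => /(congr1 -%R); rewrite opprK => ->.
by ring.
Qed.

End eigenbasis.

(** * Potentials of a cubic *)

Section cubic_primitive.
Context {R : realType}.

Definition quartic (a4 a3 a2 a1 : R) : {poly R} :=
  a4 *: 'X^4 + a3 *: 'X^3 + a2 *: 'X^2 + a1 *: 'X.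

Lemma horner_quartic a4 a3 a2 a1 t :
  (quartic a4 a3 a2 a1).[t] = a4 * t ^+ 4 + a3 * t ^+ 3 + a2 * t ^+ 2 + a1 * t.
Proof. by rewrite !(hornerD, hornerZ, hornerXn, hornerX). Qed.

Lemma horner_deriv_quartic a4 a3 a2 a1 t : ((quartic a4 a3 a2 a1)^`()).[t] =
  4 * a4 * t ^+ 3 + 3 * a3 * t ^+ 2 + 2 * a2 * t + a1.
Proof.
rewrite !(derivD, derivZ, derivXn, derivX) -polyC1.
by rewrite !(hornerD, hornerZ, hornerMn, hornerXn, hornerC); ring.
Qed.

Variables c3 c2 c1 c0 : R.
Local Notation f := (cubic c3 c2 c1 c0).

Definition cubic_primitive (x : R) : R :=
  c3 / 4 * x ^+ 4 + c2 / 3 * x ^+ 3 + c1 / 2 * x ^+ 2 + c0 * x.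

(** The mean of the cubic over the segment from [x] to [y], see
    [Rintegral_cubic_segment], in the form of the divided difference of
    [cubic_primitive]. *)
Definition cubic_average (x y : R) : R :=
  c3 / 4 * (x ^+ 3 + x ^+ 2 * y + x * y ^+ 2 + y ^+ 3)
  + c2 / 3 * (x ^+ 2 + x * y + y ^+ 2) + c1 / 2 * (x + y) + c0.

Lemma cubic_averageE x y :
  cubic_average x y * (y - x) = cubic_primitive y - cubic_primitive x.
Proof. by rewrite /cubic_average /cubic_primitive; field. Qed.

Lemma Rintegral_derive (F g : R -> R) (a b : R) : a < b ->
  (forall x, is_derive x (1 : R) F (g x)) -> continuous g ->
  \int[lebesgue_measure]_(x in `[a, b]) g x = F b - F a.
Proof.
move=> ab dF cg; rewrite /Rintegral (@continuous_FTC2 _ g F)//.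
- exact: continuous_subspaceT.
- have cF x : {for x, continuous F}.
    by apply: differentiable_continuous; apply/derivable1_diffP; case: (dF x).
  split => [x _||]; first by case: (dF x).
    by apply: cvg_at_right_filter; exact: cF.
  by apply: cvg_at_left_filter; exact: cF.
- by move=> x _; rewrite derive1E; case: (dF x).
Qed.

Lemma Rintegral_deriv_poly (p : {poly R}) (a b : R) : a < b ->
  \int[lebesgue_measure]_(x in `[a, b]) (p^`()).[x] = p.[b] - p.[a].
Proof.
move=> ab; apply: (@Rintegral_derive (horner p)) => //.
by move=> x; apply: differentiable_continuous; apply/derivable1_diffP.
Qed.

Lemma Rintegral_cubic_segment x y :
  \int[lebesgue_measure]_(t in `[0, 1]) f (x + t * (y - x)) = cubic_average x y.
Proof.
pose w := y - x.
pose p := quartic (c3 / 4 * w ^+ 3) ((c2 / 3 + c3 * x) * w ^+ 2)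
  ((c1 / 2 + c2 * x + c3 * 3 / 2 * x ^+ 2) * w) (f x).
transitivity (\int[lebesgue_measure]_(t in `[0 : R, 1]) (p^`()).[t]).
  apply: eq_Rintegral => t _; rewrite horner_deriv_quartic /cubic -/w.
  by field.
rewrite Rintegral_deriv_poly// /p !horner_quartic /cubic /cubic_average /w.
by field.
Qed.

End cubic_primitive.

Section potentials.
Context {R : realType} {d : nat}.
Local Notation mu := (cubeL R d).
Local Notation fn := ('rV[R]_d -> R).
Variables (c3 c2 c1 c0 : R) (F : fn -> R).
Local Notation f := (cubic c3 c2 c1 c0).
Local Notation Phi := (cubic_primitive c3 c2 c1 c0).
Hypothesis hF : potential f F.

Let inL4 (b : fn) : essbdd b -> inL 4 b.
Proof. by move=> hb; apply: essbdd_inL => //; rewrite ler1n. Qed.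

Lemma normL4Z (s : R) (b : fn) : essbdd b ->
  normL 4 (fun z => s * b z) = `|s| * normL 4 b.
Proof.
move=> /inL4 hb; have p1 : (1 <= 4%:E :> \bar R)%E by rewrite lee_fin ler1n.
have := LnormZ (Lfun_Sub p1 hb) s; rewrite /= => H.
rewrite /normL.
by rewrite [X in fine X]H fineM// ge0_fin_numE ?Lnorm_ge0//;
  move: hb; rewrite /inL inE => /andP[_]; rewrite inE.
Qed.

(** Differentiating [F] along the ray spanned by [b] gives a polynomial, whose
    primitive is explicit; hence a potential of [f] is, up to the constant
    [F 0], the integral of the primitive of [f]. *)
Lemma potentialE (b : fn) : essbdd b ->
  F b = F (fun=> 0) + \int[mu]_z Phi (b z).
Proof.
move=> hb.
pose A k : R := \int[mu]_z (b z ^+ k).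
have ib k : mu.-integrable setT (EFin \o (fun z => b z ^+ k)).
  by apply: essbdd_integrable; exact: essbddX.
have iZ c k : mu.-integrable setT (EFin \o (fun z => c * b z ^+ k)).
  by apply: essbdd_integrable; apply: essbddZ; exact: essbddX.
have lin4 a4 a3 a2 a1 : \int[mu]_z (a4 * b z ^+ 4 + a3 * b z ^+ 3 + a2 * b z ^+ 2
    + a1 * b z ^+ 1) = a4 * A 4%N + a3 * A 3%N + a2 * A 2%N + a1 * A 1%N.
  have hX c k := essbddZ c (essbddX k hb).
  have i2 := essbdd_integrable (essbddD (hX a4 4) (hX a3 3)).
  have i3 := essbdd_integrable (essbddD (essbddD (hX a4 4) (hX a3 3)) (hX a2 2)).
  by rewrite !RintegralD ?RintegralZl.
pose p := quartic (c3 / 4 * A 4%N) (c2 / 3 * A 3%N) (c1 / 2 * A 2%N) (c0 * A 1%N).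
have intf t : \int[mu]_z (f (t * b z) * b z) = (p^`()).[t].
  transitivity (\int[mu]_z ((c3 * t ^+ 3) * b z ^+ 4 + (c2 * t ^+ 2) * b z ^+ 3
      + (c1 * t) * b z ^+ 2 + c0 * b z ^+ 1)).
    by apply: eq_Rintegral => z _; rewrite /cubic; ring.
  by rewrite lin4 /p horner_deriv_quartic; field.
pose g t : R := F (fun z => t * b z).
have dg t : is_derive t (1 : R) g (p^`()).[t].
  have cg : s^-1 *: ((g \o shift t) (s *: (1 : R)) - g t) @[s --> 0^'] --> (p^`()).[t].
    apply/cvgrPdist_le => eps eps0; rewrite -intf.
    have B1 : 0 < normL 4 b + 1 by rewrite ltr_wpDl// normL_ge0.
    have [del del0 H] := hF (inL4 (essbddZ t hb)) (divr_gt0 eps0 B1).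
    near=> s.
    have s0 : s != 0 by near: s; exact: nbhs_dnbhs_neq.
    have sdel : `|s| <= del / (normL 4 b + 1).
      by near: s; apply: dnbhs0_le; rewrite divr_gt0.
    have := H _ (inL4 (essbddZ s hb)); rewrite normL4Z//.
    (* The radius [del] given by differentiability bounds the norm of the
       direction [s * b], not [s]; the summand 1 avoids dividing by a norm
       that may vanish. *)
    have hs : `|s| * normL 4 b <= del.
      rewrite (le_trans _ (_ : `|s| * (normL 4 b + 1) <= _))//.
        by rewrite ler_wpM2l// lerDl.
      by rewrite -ler_pdivlMr.
    move=> /(_ hs).
    have -> : (fun z => t * b z + s * b z) = (fun z => (s + t) * b z).
      by apply/funext => z; rewrite mulrDl addrC.
    have -> : \int[mu]_z (f (t * b z) * (s * b z)) = s * \int[mu]_z (f (t * b z) * b z).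
      rewrite -RintegralZl//.
        by apply: eq_Rintegral => z _; rewrite mulrCA.
      apply: essbdd_integrable; apply: essbddM => //.
      have htb := essbddZ t hb.
      rewrite /cubic; apply: essbddD; last exact: essbdd_cst.
      apply: essbddD; last exact: essbddZ.
      by apply: essbddD; apply: essbddZ; exact: essbddX.
    rewrite /= -/(g (s + t)) -/(g t) [s%:A]mulr1; set I := \int[_]_z _ => hI.
    have -> : I - s^-1 *: (g (s + t) - g t) = - (s^-1 * (g (s + t) - g t - s * I)).
      by rewrite /GRing.scale/=; field.
    rewrite normrN normrM normfV ler_pdivrMl ?normr_gt0//.
    apply: le_trans hI _; rewrite mulrCA ler_wpM2l//.
    by rewrite -mulrA ler_piMr ?(ltW eps0)// ler_pdivrMl// mulr1 lerDl.
  by apply: DeriveDef; [exact: cvgP cg|exact: cvg_lim cg].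
have /(is_derive_0_is_cst 1 0) : forall t : R, is_derive t (1 : R) (g \- horner p) 0.
  by move=> t; rewrite -[X in is_derive _ _ _ X](subrr (p^`()).[t]); exact: is_deriveB.
rewrite /g/= /p !horner_quartic.
have -> : (fun z => 1 * b z) = b by apply/funext => z; rewrite mul1r.
have -> : (fun z => 0 * b z) = (fun=> 0) by apply/funext => z; rewrite mul0r.
have -> : \int[mu]_z Phi (b z) =
    c3 / 4 * A 4%N + c2 / 3 * A 3%N + c1 / 2 * A 2%N + c0 * A 1%N.
  by rewrite -lin4; apply: eq_Rintegral => z _; rewrite /cubic_primitive expr1.
rewrite !expr0n/= !expr1n !mulr0 !mulr1 !addr0 subr0.
by move=> <-; rewrite subrK.
Unshelve. all: by end_near. Qed.

Lemma normL_ae0 (w : fn) : measurable_fun setT w -> w = (fun=> 0) %[ae mu] ->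
  normL 4 w = 0.
Proof.
move=> mw w0; rewrite /normL unlock /Lnorm.
rewrite (ae_eq_integral (cst 0%E))//.
- by rewrite integral0 poweR0r// invr_neq0.
- apply/measurable_EFinP; apply: (measurableT_comp (measurable_powR _)).
  exact: measurableT_comp.
- by apply: filterS w0 => z /= /(_ I) -> _; rewrite normr0 powR0.
Qed.

Lemma inL_ae0 (p : R) (w : fn) : 1 <= p -> measurable_fun setT w ->
  w = (fun=> 0) %[ae mu] -> inL p w.
Proof.
move=> p1 mw w0; apply: essbdd_inL => //; split => //; exists 0.
by apply: filterS w0 => z /(_ I) ->; rewrite normr0.
Qed.

(** [F] acts on representatives, but its differentiability forces it to respect
    almost everywhere equality. *)
Lemma potential_ae (b x : fn) : essbdd b -> measurable_fun setT x ->
  x = b %[ae mu] -> F x = F b.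
Proof.
move=> hb mx xb; pose w z := x z - b z.
have mw : measurable_fun setT w by apply: measurable_funB => //; case: hb.
have w0 : w = (fun=> 0) %[ae mu].
  by apply: filterS xb => z /= /[apply]; rewrite /w => ->; rewrite subrr.
have [del del0 H] := hF (inL4 hb) ltr01.
have w4 : inL 4 w by apply: inL_ae0 => //; rewrite ler1n.
have := H _ w4; rewrite normL_ae0// mulr0 normr_le0 => /(_ (ltW del0)).
have -> : (fun z => b z + w z) = x by apply/funext => z; rewrite /w addrC subrK.
have -> : \int[mu]_z (f (b z) * w z) = 0.
  have mb : measurable_fun setT b by case: hb.
  rewrite (@Rintegral_ae _ _ _ (fun=> 0))//.
  - by rewrite /Rintegral integral0.
  - rewrite /cubic; apply: measurable_funM => //.
    by repeat (apply: measurable_funD => // || apply: measurable_funM => //);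
       exact: measurable_funX.
  - by apply: filterS w0 => z /= /[apply] ->; rewrite mulr0.
by rewrite subr0 subr_eq0 => /eqP.
Qed.

End potentials.

(** * Separation of variables *)

Section finite_rank.
Context {R : realType} {d : nat} {X : Type}.
Local Notation mu := (cubeL R d).
Local Notation fn := ('rV[R]_d -> R).
Variable C : (X -> R) -> Prop.
Hypothesis C_cst : forall c, C (fun=> c).
Hypothesis C_add : forall a b, C a -> C b -> C (fun x => a x + b x).
Hypothesis C_mul : forall a b, C a -> C b -> C (fun x => a x * b x).

(** Finite sums of products of a coefficient depending on the parameter and a
    function on the cube.  Integrating such a sum over the cube only involves
    its coefficients, so that continuity and measurability of the integral in
    the parameter are instances of a single statement,
    [finite_rank_integral], for a class [C] of coefficients. *)
Inductive finite_rank : (X -> fn) -> Prop :=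
| finite_rank_tensor a b : C a -> essbdd b -> finite_rank (fun x z => a x * b z)
| finite_rankD phi psi : finite_rank phi -> finite_rank psi ->
    finite_rank (fun x z => phi x z + psi x z).

Lemma finite_rank_cst c : finite_rank (fun _ _ => c).
Proof.
rewrite (_ : (fun _ _ => c) = (fun (_ : X) (_ : 'rV[R]_d) => c * 1)).
  by apply: finite_rank_tensor => //; exact: essbdd_cst.
by apply/funext => x; apply/funext => z; rewrite mulr1.
Qed.

Lemma finite_rankM phi psi : finite_rank phi -> finite_rank psi ->
  finite_rank (fun x z => phi x z * psi x z).
Proof.
elim=> [a b Ca hb|phi1 phi2 _ IH1 _ IH2] hpsi; last first.
  rewrite (_ : (fun x z => _) =
      (fun x z => phi1 x z * psi x z + phi2 x z * psi x z)).
    by apply: finite_rankD; [exact: IH1|exact: IH2].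
  by apply/funext => x; apply/funext => z; rewrite mulrDl.
elim: hpsi => [a' b' Ca' hb'|psi1 psi2 _ IH1 _ IH2]; last first.
  rewrite (_ : (fun x z => _) =
      (fun x z => a x * b z * psi1 x z + a x * b z * psi2 x z)).
    exact: finite_rankD.
  by apply/funext => x; apply/funext => z; rewrite mulrDr.
rewrite (_ : (fun x z => _) = (fun x z => (a x * a' x) * (b z * b' z))).
  by apply: finite_rank_tensor; [exact: C_mul|exact: essbddM].
by apply/funext => x; apply/funext => z; rewrite mulrACA.
Qed.

Lemma finite_rankX phi n : finite_rank phi -> finite_rank (fun x z => phi x z ^+ n).
Proof.
move=> hphi; elim: n => [|n IH].
  rewrite (_ : (fun x z => _) = (fun _ _ => 1)); first exact: finite_rank_cst.
  by apply/funext => x; apply/funext => z; rewrite expr0.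
rewrite (_ : (fun x z => _) = (fun x z => phi x z * phi x z ^+ n)).
  exact: finite_rankM.
by apply/funext => x; apply/funext => z; rewrite exprS.
Qed.

Lemma finite_rank_sum n (phi : 'I_n -> X -> fn) : (forall i, finite_rank (phi i)) ->
  finite_rank (fun x z => \sum_(i < n) phi i x z).
Proof.
elim: n phi => [|n IH] phi hphi.
  rewrite (_ : (fun x z => _) = (fun _ _ => 0)); first exact: finite_rank_cst.
  by apply/funext => x; apply/funext => z; rewrite big_ord0.
rewrite (_ : (fun x z => _) =
    (fun x z => phi ord0 x z + \sum_(i < n) phi (lift ord0 i) x z)).
  by apply: finite_rankD => //; apply: IH.
by apply/funext => x; apply/funext => z; rewrite big_ord_recl.
Qed.

Lemma finite_rank_essbdd phi x : finite_rank phi -> essbdd (phi x).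
Proof. by elim=> *; [exact: essbddZ|exact: essbddD]. Qed.

Lemma finite_rank_integral phi : finite_rank phi -> C (fun x => \int[mu]_z phi x z).
Proof.
elim=> [a b Ca hb|phi1 phi2 h1 IH1 h2 IH2].
  rewrite (_ : (fun x => _) = (fun x => a x * \int[mu]_z b z)); first exact: C_mul.
  by apply/funext => x; rewrite RintegralZl//; exact: essbdd_integrable.
rewrite (_ : (fun x => _) = (fun x => \int[mu]_z phi1 x z + \int[mu]_z phi2 x z)).
  exact: C_add.
by apply/funext => x; rewrite RintegralD//; apply: essbdd_integrable;
  exact: finite_rank_essbdd.
Qed.

Lemma finite_rank_average c3 c2 c1 c0 phi psi : finite_rank phi -> finite_rank psi ->
  finite_rank (fun x z => cubic_average c3 c2 c1 c0 (phi x z) (psi x z)).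
Proof.
move=> hphi hpsi; rewrite /cubic_average.
by repeat (apply: finite_rankD || apply: finite_rankM || apply: finite_rankX ||
  apply: finite_rank_cst || assumption).
Qed.

End finite_rank.

(** * One deterministic step: coordinates and energy *)

Section avf_coordinates.
Context {R : realType} {d : nat} {lam : nat -> R} {e : nat -> 'rV[R]_d -> R}.
Local Notation mu := (cubeL R d).
Local Notation fn := ('rV[R]_d -> R).
Hypothesis he : dirichlet_eigenbasis lam e.
Variables (c3 c2 c1 c0 : R).
Local Notation f := (cubic c3 c2 c1 c0).
Implicit Types u v w : fn.

Definition average_coord N (p y : 'rV[R]_N) (i : 'I_N) : R :=
  inner (fun z => cubic_average c3 c2 c1 c0 (comb e p z) (comb e y z)) (e i).

Definition avf_coords N (h : R) (p q y qb : 'rV[R]_N) : Prop :=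
  forall i : 'I_N, y ord0 i = p ord0 i + h * ((q ord0 i + qb ord0 i) / 2) /\
    qb ord0 i = q ord0 i - h * (lam i * ((p ord0 i + y ord0 i) / 2))
                - h * average_coord p y i.

Let eigen_inL i : inL 2 (e i). Proof. exact: (eigen_inL he). Qed.
Let comb_inL N (p : 'rV[R]_N) : inL 2 (comb e p). Proof. exact: (comb_inL he). Qed.
Hint Resolve eigen_inL comb_inL : core.

Lemma comb_lin N (p q : 'rV[R]_N) (a : R) z :
  comb e (p + a *: q) z = comb e p z + a * comb e q z.
Proof.
rewrite /comb mulr_sumr -big_split/=; apply: eq_bigr => i _.
by rewrite !mxE mulrDl mulrA.
Qed.

Lemma coords_eq N (x : fn) (p : 'rV[R]_N) : inL 2 x -> x = comb e p %[ae mu] ->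
  coords e N x = p.
Proof. by move=> hx /(coords_ae he N hx (comb_inL p)) ->; rewrite (coords_comb he). Qed.

(** Every term but [v] is produced by the projection, so the right-hand side of
    the velocity equation is a combination even when nothing is known about
    the unknown position [u1]. *)
Lemma avf_rhs N h u v u1 (q : 'rV[R]_N) : inL 2 u -> v = comb e q %[ae mu] ->
  (fun z => v z + h * LambdaN e N (fun y => (u y + u1 y) / 2) z
   - h * projN e N (fun y => \int[lebesgue_measure]_(t in `[0, 1])
              f (u y + t * (u1 y - u y))) z) =
  comb e (\row_(i < N) (q ord0 i
    - h * (lam i * inner (fun y => (u y + u1 y) / 2) (e i))
    - h * inner (fun z => cubic_average c3 c2 c1 c0 (u z) (u1 z)) (e i))) %[ae mu].
Proof.
move=> hu vq.
apply: filterS2 vq (LambdaN_coords he N (fun y => (u y + u1 y) / 2)) => z /= + + _.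
move=> /(_ I) -> /(_ I) ->; rewrite /projN /comb !mulr_sumr -big_split/= -sumrB.
apply: eq_bigr => i _; rewrite !mxE.
have -> : (fun y => \int[lebesgue_measure]_(t in `[0, 1]) f (u y + t * (u1 y - u y))) =
    (fun y => cubic_average c3 c2 c1 c0 (u y) (u1 y)).
  by apply/funext => y; rewrite Rintegral_cubic_segment.
by ring.
Qed.

(** The velocity equation shows that [vbar] is a combination, and then the
    position equation that [u1] is one; only after this can the force be
    rewritten in terms of the coordinates of [u1]. *)
Lemma avf_stepP N h u v u1 vbar (p q : 'rV[R]_N) : inL 2 u ->
  u = comb e p %[ae mu] -> v = comb e q %[ae mu] ->
  avf_step e f N h u v u1 vbar ->
  [/\ u1 = comb e (coords e N u1) %[ae mu],
      vbar = comb e (coords e N vbar) %[ae mu] &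
      avf_coords h p q (coords e N u1) (coords e N vbar)].
Proof.
move=> hu up vq [hu1 hvb u1E vbE].
have mu0 := inL_measurable hu; have mu1 := inL_measurable hu1.
have mcomb (c : 'rV[R]_N) := inL_measurable (comb_inL c).
have vb' := ae_eq_trans vbE (avf_rhs h u1 hu vq).
move: vb'; set qb := (\row_(i < N) _ : 'rV[R]_N) => vb'.
pose y := p + (h / 2) *: (q + 1 *: qb).
have u1y : u1 = comb e y %[ae mu].
  apply: ae_eq_trans u1E _.
  apply: filterS3 up vq vb' => z /= + + + _ => /(_ I) -> /(_ I) -> /(_ I) ->.
  by rewrite /y comb_lin comb_lin; ring.
rewrite (coords_eq hu1 u1y) (coords_eq hvb vb'); split => // i.
split; first by rewrite /y !mxE; ring.
rewrite {1}/qb mxE /average_coord; congr (_ - h * (_ * _) - h * _).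
  transitivity (inner (fun z => 2^-1 * (comb e p z + comb e y z)) (e i)).
    apply: inner_ae.
    - apply: measurable_funM => //.
      exact: measurable_funD.
    - apply: measurable_funM => //.
      exact: measurable_funD.
    - exact: inL_measurable (eigen_inL i).
    - by apply: filterS2 up u1y => z /= + + _ => /(_ I) -> /(_ I) ->; rewrite mulrC.
  rewrite innerZl//; last exact: inL2D.
  by rewrite innerDl// !(inner_comb_lt he) mulrC.
have mavg (x x' : fn) : measurable_fun setT x -> measurable_fun setT x' ->
    measurable_fun setT (fun z => cubic_average c3 c2 c1 c0 (x z) (x' z)).
  move=> mx mx'; rewrite /cubic_average.
  repeat first [exact: measurable_cst | apply: measurable_funX; assumption
    | apply: measurable_funD | apply: measurable_funM | assumption].
apply: inner_ae.
- exact: mavg.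
- exact: mavg.
- exact: inL_measurable (eigen_inL i).
- by apply: filterS2 up u1y => z /= + + _ => /(_ I) -> /(_ I) ->.
Qed.

(** Conversely, coordinates solving the system produce a solution of the scheme:
    this transfers the unique solvability of the scheme to the system. *)
Lemma avf_step_comb N h (p q y qb : 'rV[R]_N) : avf_coords h p q y qb ->
  avf_step e f N h (comb e p) (comb e q) (comb e y) (comb e qb).
Proof.
move=> H; split => //.
  apply: aeW => z _; rewrite /comb -big_split/= mulr_suml mulr_sumr -big_split/=.
  by apply: eq_bigr => i _; rewrite (H i).1; ring.
apply: ae_eq_sym; apply: ae_eq_trans (avf_rhs h _ _ (aeW _ _)) _ => //.
apply: aeW => z _; apply: eq_bigr => i _; congr (_ * _).
rewrite mxE (H i).2; congr (_ - h * (_ * _) - _).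
transitivity (inner (fun z => 2^-1 * (comb e p z + comb e y z)) (e i)).
  by congr inner; apply/funext => z'; rewrite mulrC.
rewrite innerZl//; last exact: inL2D.
by rewrite innerDl// !(inner_comb_lt he) mulrC.
Qed.

Lemma inVN_comb N (p : 'rV[R]_N) : inVN e N (comb e p).
Proof. by split => //; apply: aeW => z _; rewrite projN_comb (coords_comb he). Qed.

Lemma avf_coords_unique hbar N h (p q y qb y' qb' : 'rV[R]_N) :
  avf_solvable e f hbar -> (0 < N)%N -> 0 < h -> h <= hbar ->
  avf_coords h p q y qb -> avf_coords h p q y' qb' -> y = y'.
Proof.
move=> hs N0 h0 hh H H'.
have [u1 [vb [_ uniq]]] := hs N h _ _ N0 h0 hh (inVN_comb p) (inVN_comb q).
have [yu _] := uniq _ _ (avf_step_comb H).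
have [yu' _] := uniq _ _ (avf_step_comb H').
have yy' := ae_eq_trans yu (ae_eq_sym yu').
by rewrite -(coords_comb he y) (coords_eq (comb_inL y) yy').
Qed.

Section energy.
Variables (F : fn -> R) (C1 : R).
Hypothesis hF : potential f F.
Local Notation V := (V1 lam e F C1).

Lemma V1_comb N (p q : 'rV[R]_N) : V (comb e p) (comb e q) =
  2^-1 * (\sum_(i < N) lam i * p ord0 i ^+ 2) + 2^-1 * (\sum_(i < N) q ord0 i ^+ 2)
  + F (comb e p) + C1.
Proof. by rewrite /V1 (norm_Hdot_comb he) (normL2_comb he). Qed.

Lemma V1_ae N u v (p q : 'rV[R]_N) : inL 2 u -> inL 2 v ->
  u = comb e p %[ae mu] -> v = comb e q %[ae mu] ->
  V u v = V (comb e p) (comb e q).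
Proof.
move=> hu hv up vq; rewrite /V1.
have mcomb (c : 'rV[R]_N) := inL_measurable (comb_inL c).
have mv := inL_measurable hv.
have -> : norm_Hdot lam e 1 u = norm_Hdot lam e 1 (comb e p).
  rewrite /norm_Hdot; congr (Num.sqrt (limn (series _))).
  apply/funext => i; rewrite (@inner_ae _ _ u (comb e p))//.
  - exact: inL_measurable hu.
  - exact: inL_measurable (eigen_inL i).
have -> : normL 2 v ^+ 2 = normL 2 (comb e q) ^+ 2.
  rewrite !normL2_sqr//; transitivity (inner (comb e q) v); first exact: inner_ae.
  by rewrite innerC; exact: inner_ae.
rewrite (potential_ae hF (comb_essbdd he p) (inL_measurable hu) up)//.
Qed.

(** Pointwise, the force tested against the displacement is the increment of the
    primitive of the cubic, by definition of the divided difference. *)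
Lemma potential_increment N (p y : 'rV[R]_N) :
  F (comb e y) - F (comb e p) =
  \sum_(i < N) (y ord0 i - p ord0 i) * average_coord p y i.
Proof.
have bp := comb_essbdd he p; have by_ := comb_essbdd he y.
have bavg : essbdd (fun z => cubic_average c3 c2 c1 c0 (comb e p z) (comb e y z)).
  rewrite /cubic_average; repeat (apply: essbddD || apply: essbddM ||
    apply: essbddX || apply: essbdd_cst || assumption).
have bPhi x : essbdd x -> essbdd (fun z => cubic_primitive c3 c2 c1 c0 (x z)).
  move=> bx; rewrite /cubic_primitive; repeat (apply: essbddD || apply: essbddM ||
    apply: essbddX || apply: essbdd_cst || assumption).
rewrite (potentialE hF by_) (potentialE hF bp) opprD addrACA subrr add0r.
rewrite -RintegralB//; try by apply: essbdd_integrable; exact: bPhi.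
under eq_Rintegral do rewrite -cubic_averageE.
transitivity (inner (comb e (y + (-1) *: p))
    (fun z => cubic_average c3 c2 c1 c0 (comb e p z) (comb e y z))).
  by apply: eq_Rintegral => z _; rewrite comb_lin; ring.
rewrite (inner_comb he); last by apply: essbdd_inL => //; rewrite ler1n.
by apply: eq_bigr => i _; rewrite !mxE mulN1r innerC.
Qed.

(** The averaged force has exactly the increment of [F] as its work over the
    step, and this work is what the kinetic and elastic energies lose, so the
    deterministic part of the scheme conserves the energy. *)
Lemma avf_energy N h (p q y qb : 'rV[R]_N) : avf_coords h p q y qb ->
  V (comb e y) (comb e qb) = V (comb e p) (comb e q).
Proof.
move=> H; apply/eqP; rewrite -subr_eq0 !V1_comb.
set a := \sum_i _; set b := \sum_i _; set a' := \sum_i _; set b' := \sum_i _.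
have -> : 2^-1 * a + 2^-1 * b + F (comb e y) + C1 -
    (2^-1 * a' + 2^-1 * b' + F (comb e p) + C1) =
    2^-1 * (a - a' + (b - b')) + (F (comb e y) - F (comb e p)) by ring.
rewrite potential_increment /a /b /a' /b' -!sumrB -big_split/= mulr_sumr -big_split/=.
rewrite big1// => i _; have [H1 H2] := H i.
set G := average_coord p y i in H2 *.
have E1 : y ord0 i - p ord0 i = h * ((q ord0 i + qb ord0 i) / 2).
  by rewrite H1; ring.
have E2 : qb ord0 i - q ord0 i =
    - (h * (lam i * ((p ord0 i + y ord0 i) / 2) + G)) by rewrite H2; ring.
transitivity (2^-1 * (lam i * (y ord0 i - p ord0 i) * (y ord0 i + p ord0 i)
   + (qb ord0 i - q ord0 i) * (qb ord0 i + q ord0 i)) + (y ord0 i - p ord0 i) * G).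
  by ring.
by rewrite E1 E2; field.
Qed.

End energy.

End avf_coordinates.

(** * Measurability of an implicitly defined vector *)

Section measurable_zero.
Context {R : realType} {n : nat}.

Let ratv (q : 'rV[rat]_n) : 'rV[R]_n := map_mx ratr q.

Lemma rat_row_dense (x : 'rV[R]_n) (A : set 'rV[R]_n) : nbhs x A ->
  exists q : 'rV[rat]_n, A (ratv q).
Proof.
move=> /nbhs_ballP[r /= r0 rA].
have H j : exists q : rat, ball (x ord0 j) r (ratr q).
  have /rat_in_itvoo[q] : x ord0 j < x ord0 j + r by rewrite ltrDl.
  rewrite in_itv/= => /andP[q1 q2]; exists q.
  by rewrite /ball/= ltr_norml; apply/andP; split; lra.
have [q hq] := choice H.
exists (\row_j q j); apply: rA; split => // i j.
by rewrite (ord1 i) !mxE.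
Qed.

Context {dT : measure_display} {T : measurableType dT}.
Variables (g : T -> 'rV[R]_n -> R) (s : T -> 'rV[R]_n).
Hypothesis g_ge0 : forall t y, 0 <= g t y.
Hypothesis g_meas : forall y, measurable_fun setT (g ^~ y).
Hypothesis g_cont : forall t, continuous (g t).
Hypothesis g_zero : forall t y, g t y = 0 <-> y = s t.

Let box (k : nat) (y : 'rV[R]_n) : Prop :=
  forall j, `[- k%:R, k%:R]%classic (y ord0 j).

Let approx (c : R) i k m (q : 'rV[rat]_n) : set T :=
  [set t | [/\ box k (ratv q), ratv q ord0 i < c + m.+1%:R^-1 &
               g t (ratv q) < m.+1%:R^-1]].

Let le_limit (F : set_system 'rV[R]_n) (FF : ProperFilter F) (phi : 'rV[R]_n -> R)
    (a : R) y : continuous phi -> cluster F y ->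
  (forall m : nat, F [set z | phi z < a + m.+1%:R^-1]) -> phi y <= a.
Proof.
move=> cphi Fy hF; rewrite leNgt; apply/negP => /ltr_add_invr[k hk].
have : closed [set z | phi z <= a + k.+1%:R^-1].
  exact: (closed_comp (fun z _ => cphi z) (@closed_le _ (a + k.+1%:R^-1))).
move=> /closure_id cl.
have : closure [set z | phi z <= a + k.+1%:R^-1] y.
  move: Fy; rewrite clusterE; apply.
  by apply: filterS (hF k) => z /= /ltW.
by rewrite -cl/= leNgt hk.
Qed.

(** Sublevel sets of the coordinates of the zero [s t] of [g t] are expressed by
    approximate zeros with rational coordinates; bounded approximate zeros
    accumulate at a zero, which can only be [s t]. *)
Lemma measurable_unique_zero (i : 'I_n) : measurable_fun setT (fun t => s t ord0 i).
Proof.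
apply: (measurability (@RGenOInfty.G R)); first exact: RGenOInfty.measurableE.
move=> _ [_ [c ->] <-]; rewrite setTI.
(* [k] bounds the approximate zeros, [m] is their precision and [q] ranges
   over the rational candidates. *)
rewrite (_ : _ @^-1` _ = ~` (\bigcup_k \bigcap_m \bigcup_q approx c i k m q)).
  apply: measurableC; apply: bigcupT_measurable => k.
  apply: bigcapT_measurable => m; apply: countable_bigcupT_measurable => // q.
  have [Hq|Hq] := pselect (box k (ratv q) /\ ratv q ord0 i < c + m.+1%:R^-1).
    rewrite (_ : approx _ _ _ _ _ = (g ^~ (ratv q)) @^-1` `]-oo, m.+1%:R^-1[).
      by rewrite -[X in measurable X]setTI; exact: g_meas.
    apply/seteqP; split => t /=; rewrite in_itv/=; first by case.
    by case: Hq => ? ? ?; split.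
  rewrite (_ : approx _ _ _ _ _ = set0) //.
  by apply/seteqP; split => t //= -[h1 h2 _]; apply: Hq.
rewrite -[LHS]setCK; congr (~` _); apply/seteqP; split => t /=.
  rewrite in_itv/= andbT => /negP; rewrite -leNgt => sc.
  exists (Num.truncn (`|s t| + 1)).+1 => // m _ /=.
  have m0 : 0 < m.+1%:R^-1 :> R by rewrite invr_gt0.
  have nb : nbhs (s t) [set y | [/\ ball (s t) 1 y, y ord0 i < c + m.+1%:R^-1 &
       g t y < m.+1%:R^-1]].
    have n1 : nbhs (s t) (ball (s t) 1) by exact: nbhsx_ballx.
    have n2 : nbhs (s t) [set y | y ord0 i < c + m.+1%:R^-1].
      have := @coord_continuous R 1 n ord0 i (s t).
      move=> /(_ [set x | x < c + m.+1%:R^-1]); apply.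
      apply: open_nbhs_nbhs; split; first exact: open_lt.
      by rewrite /= (le_lt_trans sc)// ltrDl.
    have n3 : nbhs (s t) [set y | g t y < m.+1%:R^-1].
      have /(_ [set x | x < m.+1%:R^-1]) := @g_cont t (s t); apply.
      apply: open_nbhs_nbhs; split; first exact: open_lt.
      by rewrite /= ((g_zero t (s t)).2 erefl).
    by apply: filterS3 n1 n2 n3.
  have [q [q1 q2 q3]] := rat_row_dense nb.
  exists q => //; split => // j /=.
  have [_ /(_ ord0 j)] := q1; rewrite /ball/= => hj.
  rewrite in_itv/= -ler_norml.
  have : `|ratv q ord0 j| <= `|s t| + 1.
    rewrite -(subrK (s t ord0 j) (ratv q ord0 j)) addrC.
    rewrite (le_trans (ler_normD _ _))// lerD//; last by rewrite distrC ltW.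
    have /mapP : `|s t ord0 j| \in [seq `|s t x.1 x.2| | x : 'I_1 * 'I_n].
      by apply/mapP; exists (ord0, j) => //=; rewrite mem_enum.
    move=> [p _ ->]; rewrite [leRHS]/Num.norm/= mx_normrE.
    by apply/bigmax_geP; right => /=; exists p.
  by move=> /le_trans; apply; rewrite ltW// truncnS_gt.
move=> [k _ hk]; apply/negP; rewrite in_itv/= andbT -leNgt.
have /choice[q hq] : forall m, exists q, approx c i k m q t.
  by move=> m; have [q _ qt] := hk m I; exists q.
have cK : compact [set v : 'rV[R]_n | box k v].
  pose I : set R := `[- k%:R, k%:R]%classic.
  by apply: (@rV_compact _ n (fun=> I)) => _; exact: segment_compact.
pose F := (ratv \o q) @ \oo.
have FF : ProperFilter F by exact: fmap_proper_filter.
have FK : F [set v | box k v].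
  by exists 0%N => // m _ /=; have [] := hq m.
have [y [yK Fy]] := cK F _ FK.
have hg m : F [set z | g t z < 0 + m.+1%:R^-1].
  exists m => // m' /= mm'; rewrite add0r; have [_ _ h] := hq m'.
  by rewrite (lt_le_trans h)// lef_pV2 ?posrE// ler_nat.
have hi m : F [set z | z ord0 i < c + m.+1%:R^-1].
  exists m => // m' /= mm'; have [_ h _] := hq m'.
  by rewrite (lt_le_trans h)// lerD2l lef_pV2 ?posrE// ler_nat.
have gy : g t y = 0.
  by apply/eqP; rewrite eq_le g_ge0 andbT; exact: (le_limit FF (@g_cont t) Fy hg).
by rewrite -((g_zero t y).1 gy); exact: (le_limit FF (@coord_continuous R 1 n ord0 i) Fy hi).
Qed.

End measurable_zero.

(** * Second moment of the normal law *)

Section normal_moments.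
Context {R : realType}.
Variable s : R.
Hypothesis s_gt0 : 0 < s.
Local Notation leb := (@lebesgue_measure R).
Local Notation pdf := (normal_pdf 0 s).

Let s_neq0 : s != 0. Proof. by rewrite gt_eqF. Qed.

Lemma is_derive_normal_pdf (x : R) :
  is_derive x (1 : R) pdf (- (x / s ^+ 2) * pdf x).
Proof.
rewrite normal_pdfE//.
have E : normal_fun 0 s = expR \o (fun y : R => - (s ^+ 2 *+ 2)^-1 * y ^+ 2).
  apply/funext => y; rewrite /normal_fun/= subr0; congr expR.
  by rewrite mulNr mulrC mulNr.
have D1 : is_derive x (1 : R) (fun y : R => - (s ^+ 2 *+ 2)^-1 * y ^+ 2) (- (x / s ^+ 2)).
  apply: is_derive_eq; rewrite /GRing.scale/= !mulr1.
  by field.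
have D2 : is_derive x (1 : R) (normal_fun 0 s) (- (x / s ^+ 2) * normal_fun 0 s x).
  by rewrite E; apply: is_derive_eq; rewrite mulrC.
by apply: (is_derive_eq (is_deriveZ (normal_peak s) D2)); rewrite mulrCA.
Qed.

(** The function [- s ^+ 2 * x * pdf x] is a primitive of
    [(x ^+ 2 - s ^+ 2) * pdf x]; it vanishes at 0 and at infinity, so that the
    latter integrates to 0 on the half-line. *)
Let G (x : R) : R := - s ^+ 2 * (x * pdf x).

Let G_derive (x : R) : is_derive x (1 : R) G ((x ^+ 2 - s ^+ 2) * pdf x).
Proof.
have D := is_derive_normal_pdf x.
have D2 : is_derive x (1 : R) (fun y : R => y * pdf y)
    (x *: (- (x / s ^+ 2) * pdf x) + pdf x *: (1 : R)).
  exact: is_deriveM.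
apply: (is_derive_eq (is_deriveZ (- s ^+ 2) D2)).
by rewrite /GRing.scale/=; field.
Qed.

Let continuous_sqr (a : R) : continuous (fun x : R => (x ^+ 2 - a) * pdf x).
Proof.
move=> x; apply: cvgM; last exact: continuous_normal_pdf.
by apply: cvgB; [exact: exprn_continuous|exact: cvg_cst].
Qed.

Let G_cvg : G x @[x --> +oo] --> (0 : R).
Proof.
pose c : R := s ^+ 2 * normal_peak s * (s ^+ 2 *+ 2).
apply: (@squeeze_cvgr _ _ _ _ (fun x => - c * x^-1) (cst 0)); last exact: cvg_cst.
  near=> x; have x0 : 0 < x by near: x; exact: nbhs_pinfty_gt.
  have pdfx : pdf x = normal_peak s * expR (- (x ^+ 2 / (s ^+ 2 *+ 2))).
    by rewrite normal_pdfE// /normal_fun subr0 mulNr.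
  have hy : 0 < x ^+ 2 / (s ^+ 2 *+ 2).
    by rewrite divr_gt0 ?exprn_gt0// pmulrn_lgt0// exprn_gt0.
  have expb : expR (- (x ^+ 2 / (s ^+ 2 *+ 2))) <= (s ^+ 2 *+ 2) / x ^+ 2.
    rewrite expRN -[leRHS]invf_div lef_pV2 ?posrE ?expR_gt0//.
    by rewrite (le_trans _ (expR_ge1Dx _))// lerDr.
  rewrite /= /G !mulNr lerN2 oppr_le0; apply/andP; split; last first.
    by rewrite mulr_ge0 ?sqr_ge0// mulr_ge0 ?normal_pdf_ge0// ltW.
  rewrite pdfx.
  have -> : c * x^-1 = s ^+ 2 * (x * (normal_peak s * ((s ^+ 2 *+ 2) / x ^+ 2))).
    by rewrite /c; field; rewrite gt_eqF.
  by rewrite ler_wpM2l ?sqr_ge0// ler_wpM2l ?(ltW x0)// ler_wpM2l// normal_peak_ge0.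
rewrite -[X in _ --> X](mulr0 (- c)); apply: cvgMr.
by apply: (iffRL (@gtr0_cvgV0 R R +oo%R _ id _)); [exact: nbhs_pinfty_gt|exact: cvg_id].
Unshelve. all: by end_near. Qed.

Let mpdf2 (a : R) (D : set R) : measurable_fun D (fun x : R => ((x ^+ 2 - a) * pdf x)%:E).
Proof.
apply: measurable_funTS; apply/measurable_EFinP.
by apply: continuous_measurable_fun; exact: continuous_sqr.
Qed.

Let mpdf (D : set R) : measurable_fun D (fun x : R => (pdf x)%:E).
Proof. by apply: measurable_funTS; apply/measurable_EFinP; exact: measurable_normal_pdf. Qed.

Let msqr (D : set R) : measurable_fun D (fun x : R => (x ^+ 2 * pdf x)%:E).
Proof. by have := @mpdf2 0 D; under eq_fun do rewrite subr0. Qed.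

Let pdf_ge0 x : 0 <= pdf x. Proof. exact: normal_pdf_ge0. Qed.

Let G0 : G 0 = 0. Proof. by rewrite /G mul0r mulr0. Qed.

(** The half-line is cut at [s], where [x ^+ 2 - s ^+ 2] changes sign, so that
    both pieces only involve integrals of nonnegative functions. *)
Let head : (\int[leb]_(x in `[0%R, s]) (x ^+ 2 * pdf x)%:E + (- G s)%:E =
            (s ^+ 2)%:E * \int[leb]_(x in `[0%R, s]) (pdf x)%:E)%E.
Proof.
have cf : continuous (fun x : R => (s ^+ 2 - x ^+ 2) * pdf x).
  move=> x; apply: cvgM; last exact: continuous_normal_pdf.
  by apply: cvgB; [exact: cvg_cst|exact: exprn_continuous].
have <- : (\int[leb]_(x in `[0%R, s]) ((s ^+ 2 - x ^+ 2) * pdf x)%:E = (- G s)%:E)%E.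
  have dG (x : R) : is_derive x (1 : R) (fun y => - G y) ((s ^+ 2 - x ^+ 2) * pdf x).
    by rewrite -opprB mulNr; exact: is_deriveN.
  have H := Rintegral_derive s_gt0 dG cf.
  move: H; rewrite G0 oppr0 subr0 /Rintegral => <-; rewrite fineK//.
  apply: (@integrable_fin_num _ _ _ leb); first exact: measurable_itv.
  apply: continuous_compact_integrable; first exact: segment_compact.
  exact: continuous_subspaceT.
rewrite -ge0_integralZl_EFin//; [|by move=> x _; rewrite lee_fin|exact: mpdf|exact: sqr_ge0].
rewrite -ge0_integralD//.
- by apply: eq_integral => x _; rewrite -EFinD -EFinM; congr EFin; ring.
- by move=> x _; rewrite lee_fin mulr_ge0 ?sqr_ge0.
- exact: msqr.
- move=> x /=; rewrite in_itv/= => /andP[x0 xs]; rewrite lee_fin mulr_ge0//.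
  by rewrite subr_ge0 ler_sqr ?nnegrE// ltW.
- apply: measurable_funTS; apply/measurable_EFinP.
  exact: continuous_measurable_fun.
Qed.

Let tail : (\int[leb]_(x in `[s, +oo[) (x ^+ 2 * pdf x)%:E = (- G s)%:E +
            (s ^+ 2)%:E * \int[leb]_(x in `[s, +oo[) (pdf x)%:E)%E.
Proof.
have cG (x : R) : {for x, continuous G}.
  by apply: differentiable_continuous; apply/derivable1_diffP; case: (G_derive x).
have sq x : s <= x -> 0 <= (x ^+ 2 - s ^+ 2) * pdf x.
  move=> sx; have x0 : 0 <= x by rewrite (le_trans _ sx)// ltW.
  by rewrite mulr_ge0// subr_ge0 ler_sqr// nnegrE ltW.
have <- : (\int[leb]_(x in `[s, +oo[) ((x ^+ 2 - s ^+ 2) * pdf x)%:E = (- G s)%:E)%E.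
  rewrite (@ge0_continuous_FTC2y _ _ G s 0)//.
  - by rewrite -EFinB sub0r.
  - by apply: continuous_subspaceT; exact: continuous_sqr.
  - by move=> x _; case: (G_derive x).
  - by apply: cvg_at_right_filter; exact: cG.
  - by move=> x _; rewrite derive1E; case: (G_derive x).
rewrite -ge0_integralZl_EFin//; [|by move=> x _; rewrite lee_fin|exact: mpdf|exact: sqr_ge0].
rewrite -ge0_integralD//.
- by apply: eq_integral => x _; rewrite -EFinM -EFinD; congr EFin; ring.
- by move=> x /=; rewrite in_itv/= andbT => sx; rewrite lee_fin sq.
- exact: mpdf2.
- by move=> x _; rewrite -EFinM lee_fin mulr_ge0 ?sqr_ge0.
- by apply: measurable_funeM; exact: mpdf.
Qed.

Let split_half (g : R -> R) : (forall x, 0 <= g x) -> continuous g ->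
  (\int[leb]_(x in [set x | (0 <= x)%R]) (g x)%:E =
   \int[leb]_(x in `[0%R, s]) (g x)%:E + \int[leb]_(x in `[s, +oo[) (g x)%:E)%E.
Proof.
move=> g0 cg; have mg (D : set R) : measurable_fun D (EFin \o g).
  by apply: measurable_funTS; apply/measurable_EFinP; exact: continuous_measurable_fun.
rewrite -set_itvcy -(integral_itv_bndo_bndc (mg _)).
have -> : `[0, +oo[%classic = `[0, s[ `|` `[s, +oo[ :> set R.
  by rewrite -itv_bndbnd_setU// bnd_simp// ltW.
rewrite ge0_integral_setU//.
- exact: mg.
- by move=> x _; rewrite lee_fin.
- rewrite disj_set2E; apply/eqP; apply/seteqP; split => x //= [].
  rewrite !in_itv/= andbT => /andP[_ xs] sx.
  by have := lt_le_trans xs sx; rewrite ltxx.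
Qed.

Lemma integral_sqr_normal_pdf : (\int[leb]_x (x ^+ 2 * pdf x)%:E = (s ^+ 2)%:E)%E.
Proof.
have even : pdf =1 pdf \o -%R.
  by move=> x /=; rewrite !normal_pdfE// /normal_fun !subr0 sqrrN.
have sqr0 x : 0 <= x ^+ 2 * pdf x by rewrite mulr_ge0 ?sqr_ge0.
have csqr : continuous (fun x : R => x ^+ 2 * pdf x).
  by move=> x; apply: cvgM; [exact: exprn_continuous|exact: continuous_normal_pdf].
have cpdf : continuous pdf by exact: continuous_normal_pdf.
rewrite ge0_symfun_integralT//; last by move=> x /=; rewrite sqrrN -[pdf (- x)]even.
rewrite split_half// tail addeA head.
rewrite -ge0_muleDr; [|by apply: integral_ge0 => x _; rewrite lee_fin..].
rewrite -split_half// muleCA -ge0_symfun_integralT//.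
by rewrite integral_normal_pdf mule1.
Qed.

(** The density defining [normal_prob] is a Radon-Nikodym derivative, and these
    are unique almost everywhere. *)
Lemma ge0_integral_normal_prob (g : R -> R) : measurable_fun setT g ->
  (forall x, 0 <= g x) ->
  (\int[normal_prob 0 s]_x (g x)%:E = \int[leb]_x (g x * pdf x)%:E)%E.
Proof.
move=> mg g0.
have dom := @normal_prob_dominates R 0 s.
rewrite -(Radon_Nikodym_SigmaFinite.change_of_variables dom)//; [|exact/measurable_EFinP].
have mRN := measurable_int _ (Radon_Nikodym_SigmaFinite.f_integrable dom).
apply: ae_eq_integral => //.
- by apply: emeasurable_funM => //; exact/measurable_EFinP.
- by apply/measurable_EFinP; apply: measurable_funM => //; exact: measurable_normal_pdf.
under [X in ae_eq _ _ _ X]eq_fun do rewrite EFinM.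
apply: ae_eqe_mul2l; apply: integral_ae_eq => //.
- exact: Radon_Nikodym_SigmaFinite.f_integrable.
- by apply/measurable_EFinP; exact: measurable_normal_pdf.
- by move=> E _ mE; rewrite -(Radon_Nikodym_SigmaFinite.f_integral dom mE).
Qed.

End normal_moments.

(** * Gaussian and independent random variables *)

Section random_variables.
Context {R : realType} {dO : measure_display} {Omega : measurableType dO}.
Variable P : probability Omega R.
Implicit Types X Y : Omega -> R.

Lemma sqr_integrable_Lfun2 X : measurable_fun setT X ->
  (\int[P]_w (X w ^+ 2)%:E < +oo)%E -> X \in Lfun P 2%:E.
Proof.
move=> mX iX; rewrite inE; apply/andP; split; rewrite inE//= /finite_norm.
rewrite unlock /Lnorm poweR_lty//; apply: le_lt_trans iX.
rewrite le_eqVlt; apply/predU1P; left.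
by apply: eq_integral => w _ /=; rewrite powR_mulrn// -normrX ger0_norm ?sqr_ge0.
Qed.

Definition rv X (mX : measurable_fun setT X) : {RV P >-> R} := mfun_Sub (mem_set mX).

Lemma gaussian_sqr X (s2 : R) : measurable_fun setT X -> 0 < s2 ->
  gaussian P X 0 s2 -> (\int[P]_w (X w ^+ 2)%:E = s2%:E)%E.
Proof.
move=> mX s20 gX; have sqrt0 : 0 < Num.sqrt s2 by rewrite sqrtr_gt0.
have msq : measurable_fun setT (fun x : R => x ^+ 2) by exact: measurable_funX.
(* [normal_prob] lives on [measurableTypeR R], whose display differs from the
   one of the codomain of [X] although the measurable sets are the same. *)
have mX' : @measurable_fun _ _ Omega (measurableTypeR R) setT X by exact: mX.
pose X' : {RV P >-> measurableTypeR R} :=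
  @mfun_Sub _ _ Omega (measurableTypeR R) X (mem_set mX').
have := @ge0_integral_distribution _ _ _ _ _ P X' (fun x : R => (x ^+ 2)%:E).
move=> <-; [|exact/measurable_EFinP|by move=> y; rewrite lee_fin sqr_ge0].
transitivity (\int[normal_prob 0 (Num.sqrt s2)]_x (x ^+ 2)%:E)%E; last first.
  rewrite ge0_integral_normal_prob//; last by move=> x; exact: sqr_ge0.
  by rewrite integral_sqr_normal_pdf// sqr_sqrtr// ltW.
by apply: eq_measure_integral => A mA _; have := gX A mA; rewrite gt_eqF.
Qed.

(** [X] and [- X] have the same law, so their means, which are opposite, are
    equal. *)
Lemma gaussian_mean0 X (s2 : R) : measurable_fun setT X ->
  X \in Lfun P 1%E -> gaussian P X 0 s2 -> gaussian P (fun w => - X w) 0 s2 ->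
  (\int[P]_w (X w)%:E = 0)%E.
Proof.
move=> mX iX gX gNX.
have mNX : measurable_fun setT (fun w => - X w) by exact: measurable_funN.
have /Lfun1_integrable {}iX := iX.
have iNX : P.-integrable setT (fun w => (- X w)%:E).
  by have := integrableN iX; apply: eq_integrable.
have E1 := @integral_distribution _ _ _ _ _ P (rv mX) EFin (@EFin_measurable R setT) iX.
have E2 := @integral_distribution _ _ _ _ _ P (rv mNX) EFin (@EFin_measurable R setT) iNX.
have E : (\int[P]_w (X w)%:E = \int[P]_w (- X w)%:E)%E.
  transitivity (\int[distribution P (rv mX)]_y y%:E)%E; first by rewrite E1.
  transitivity (\int[distribution P (rv mNX)]_y y%:E)%E; last by rewrite E2.
  apply: eq_measure_integral => A mA _.
  exact: etrans (gX A mA) (esym (gNX A mA)).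
have fin : (\int[P]_w (X w)%:E \is a fin_num)%E by exact: (integrable_fin_num measurableT iX).
have EN : (\int[P]_w (- X w)%:E = - \int[P]_w (X w)%:E)%E.
  exact: (integralN (integrable_add_def measurableT iX)).
move: E; rewrite EN -(fineK fin) -EFinN => -[] /eqP.
by rewrite -addr_eq0 -mulr2n mulrn_eq0/= => /eqP ->.
Qed.

(** Independence makes the joint law a product, so by Fubini [Y] may be
    integrated first. *)
Lemma independent_mean0 X Y : measurable_fun setT X -> measurable_fun setT Y ->
  (forall A B, measurable A -> measurable B ->
    P (X @^-1` A `&` Y @^-1` B) = (P (X @^-1` A) * P (Y @^-1` B))%E) ->
  (fun w => X w * Y w) \in Lfun P 1%E -> Y \in Lfun P 1%E ->
  (\int[P]_w (Y w)%:E = 0)%E ->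
  (\int[P]_w (X w * Y w)%:E = 0)%E.
Proof.
move=> mX mY indep /Lfun1_integrable iXY /Lfun1_integrable iY Y0.
pose PX := distribution P (rv mX); pose PY := distribution P (rv mY).
have mXY : measurable_fun setT (fun w => (X w, Y w)) by exact: measurable_fun_pair.
pose XY : {RV P >-> (R * R)%type} := mfun_Sub (mem_set mXY).
pose f (z : R * R) : \bar R := (z.1 * z.2)%:E.
have mf : measurable_fun setT f.
  apply/measurable_EFinP; apply: measurable_funM; [exact: measurable_fst|exact: measurable_snd].
have same A : measurable A -> (PX \x PY)%E A = distribution P XY A.
  apply: product_measure_unique => B C mB mC.
  by rewrite /distribution /pushforward/= -indep.
have if_ : (PX \x PY)%E.-integrable setT f.
  apply/integrableP; split => //.
  rewrite (eq_measure_integral (distribution P XY)); last by move=> A mA _; exact: same.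
  rewrite ge0_integral_distribution//; first by have /integrableP[] := iXY.
  exact: measurableT_comp.
transitivity (\int[(PX \x PY)%E]_z f z)%E.
  rewrite (eq_measure_integral (distribution P XY)); last by move=> A mA _; exact: same.
  by rewrite integral_distribution.
rewrite -integral12_prod_meas1// integral0_eq// => x _.
rewrite /fubini_F /f/=.
under eq_integral do rewrite EFinM.
have E2 := @integral_distribution _ _ _ _ _ P (rv mY) EFin (@EFin_measurable R setT) iY.
have iPY : PY.-integrable setT EFin.
  apply/integrableP; split; first exact: EFin_measurable.
  rewrite ge0_integral_distribution//; first by have /integrableP[] := iY.
  by apply: measurableT_comp => //; exact: EFin_measurable.
by rewrite integralZl// E2 [X in (_ * X)%E]Y0 mule0.
Qed.

End random_variables.

(** * The trace *)

Section trace_of_projection.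
Context {R : realType} {d : nat} {lam : nat -> R} {e : nat -> 'rV[R]_d -> R}.
Local Notation mu := (cubeL R d).
Local Notation fn := ('rV[R]_d -> R).
Hypothesis he : dirichlet_eigenbasis lam e.
Variable N : nat.
Local Notation PN := (projN e N).

Let eigen_inL i : inL 2 (e i). Proof. exact: (eigen_inL he). Qed.
Hint Resolve eigen_inL : core.

Lemma projN_inL (x : fn) : inL 2 (PN x).
Proof. by rewrite projN_comb; exact: comb_inL he _ _. Qed.
Hint Resolve projN_inL : core.

Lemma inner_projN (x y : fn) : inL 2 x -> inL 2 y -> inner (PN x) y = inner x (PN y).
Proof.
move=> hx hy; rewrite [RHS]innerC !projN_comb !(inner_comb he)//.
by apply: eq_bigr => i _; rewrite !mxE mulrC (innerC _ y) (innerC _ x).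
Qed.

Lemma inner_projN_eigen (x : fn) i : inL 2 x ->
  inner (PN x) (e i) = if (i < N)%N then inner x (e i) else 0.
Proof.
move=> hx; rewrite projN_comb; case: ltnP => iN; last by rewrite (inner_comb_ge he).
by rewrite (inner_comb_lt he _ (Ordinal iN)) mxE.
Qed.

(** The factor [N] is not optimal; any bound makes [projN] a bounded operator. *)
Lemma normL2_projN (x : fn) : inL 2 x -> normL 2 (PN x) <= N%:R * normL 2 x.
Proof.
move=> hx; rewrite -ler_sqr ?nnegrE ?normL_ge0 ?mulr_ge0 ?normL_ge0//.
rewrite projN_comb (normL2_comb he) exprMn.
apply: (@le_trans _ _ (\sum_(i < N) normL 2 x ^+ 2)).
  apply: ler_sum => i _; rewrite mxE -real_normK ?num_real// ler_sqr ?nnegrE ?normL_ge0//.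
  apply: le_trans (cauchy_schwarz hx (eigen_inL i)) _.
  have -> : normL 2 (e i) = 1.
    apply/eqP; rewrite -(@eqrXn2 _ 2)// ?normL_ge0// normL2_sqr//.
    by rewrite (eigen_inner he) eqxx expr1n.
  by rewrite mulr1.
rewrite sumr_const card_ord -[X in X <= _]mulr_natl ler_wpM2r ?sqr_ge0//.
by rewrite -natrX ler_nat; case: N => // n; rewrite -mulnn leq_pmulr.
Qed.

Variables (Q S : fn -> fn).
Hypothesis hS : is_sqrt_operator Q S.
Let A (x : fn) : fn := PN (S x).

(** [projN] and [S] are symmetric, so the adjoint of their composition is the
    composition in the other order; this witness makes the choice in [adjoint]
    meaningful. *)
Lemma is_adjoint_projection : is_adjoint A (fun x => S (PN x)).
Proof.
have [[Sin Slin [C SC]] Ssym _ _] := hS.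
split; last by move=> x y hx hy; rewrite inner_projN//; [exact: Ssym|exact: Sin].
split => [x hx|a x y hx hy|]; first exact: Sin.
- have -> : PN (fun z => a * x z + y z) = (fun z => a * PN x z + PN y z).
    apply/funext => z; rewrite /projN mulr_sumr -big_split/=.
    apply: eq_bigr => i _; rewrite innerDl//; last exact: inL2Z.
    by rewrite innerZl// mulrDl mulrA.
  exact: Slin.
- exists (`|C| * N%:R) => x hx; rewrite -mulrA.
  apply: le_trans (SC _ (projN_inL x)) _.
  apply: (@le_trans _ _ (`|C| * normL 2 (PN x))).
    by rewrite ler_wpM2r ?normL_ge0// ler_norm.
  by rewrite ler_wpM2l// normL2_projN.
Qed.

(** For [i < N] the projection disappears from the diagonal term, and moving
    [S] and the adjoint across the inner product leaves [S (S (e i))], which is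
    [Q (e i)].  The remaining diagonal terms vanish. *)
Lemma trace_projection (hQ : bounded_operator Q) :
  trace e (fun x => A (adjoint A x)) = \sum_(i < N) inner (Q (e i)) (e i).
Proof.
have [[Sin _ _] Ssym _ SS] := hS; have [Qin _ _] := hQ.
have [[Bin _ _] Badj] : is_adjoint A (adjoint A).
  by apply: xgetPex; eexists; exact: is_adjoint_projection.
rewrite /trace (@limn_series_finite _ N) => [|i Ni]; last first.
  rewrite /A inner_projN_eigen; last by apply: Sin; exact: Bin.
  by rewrite ltnNge Ni.
apply: eq_bigr => i _; have hBe := Bin _ (eigen_inL i); have hSe := Sin _ (eigen_inL i).
rewrite /A inner_projN_eigen ?ltn_ord//; last exact: Sin.
rewrite Ssym// innerC -Badj// inner_projN_eigen ?ltn_ord//; last exact: Sin.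
apply: inner_ae; last exact: SS.
- by apply: (@inL_measurable _ _ 2); exact: Sin.
- by apply: (@inL_measurable _ _ 2); exact: Qin.
- exact: inL_measurable (eigen_inL i).
Qed.

End trace_of_projection.

(** * Increments of the Wiener process *)

Section wiener_increments.
Context {R : realType} {d : nat}.
Local Notation fn := ('rV[R]_d -> R).

Lemma sigma_algebra_borelL2 : sigma_algebra (inL 2) (@borelL2 R d).
Proof. exact: smallest_sigma_algebra. Qed.

Lemma openL2_inner (x : fn) (c : R) : inL 2 x ->
  openL2 [set y | inL 2 y /\ c < inner y x].
Proof.
move=> hx; split=> [y []//|y /= [hy cy]].
have x1 : 0 < normL 2 x + 1 by rewrite ltr_wpDl ?normL_ge0.
exists ((inner y x - c) / (normL 2 x + 1)); first by rewrite divr_gt0 ?subr_gt0.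
move=> y' hy' yy'; split => //.
have hd : inL 2 (fun z => y' z - y z) by exact: inL2B.
have := cauchy_schwarz hd hx; rewrite innerBl// => le1.
have : `|inner y' x - inner y x| < inner y x - c.
  apply: (le_lt_trans le1); move: yy'; rewrite ltr_pdivlMr// => yy'.
  by apply: le_lt_trans yy'; rewrite ler_wpM2l ?normL_ge0// lerDl.
by rewrite ltr_norml => /andP[+ _]; lra.
Qed.

(** The sets [A] with this property form a sigma-algebra, which contains the
    open rays because [inner ^~ x] is continuous. *)
Lemma borelL2_inner (x : fn) (A : set R) : inL 2 x -> measurable A ->
  borelL2 [set y | inL 2 y /\ A (inner y x)].
Proof.
move=> hx mA.
have [b0 bC bU] := sigma_algebra_borelL2.
pose G := [set B : set R | borelL2 [set y | inL 2 y /\ B (inner y x)]].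
have sG : sigma_algebra setT G.
  split.
  - rewrite /G/= (_ : [set y | _] = set0)//.
    by apply/seteqP; split => y // [].
  - move=> B GB; rewrite /G/=.
    rewrite (_ : [set y | _] = inL 2 `\` [set y | inL 2 y /\ B (inner y x)]).
      exact: bC.
    apply/seteqP; split => y /= [hy].
      by move=> [_ nB]; split => // -[].
    by move=> nB; split => //; split => // By; apply: nB.
  - move=> B GB; rewrite /G/=.
    rewrite (_ : [set y | _] = \bigcup_i [set y | inL 2 y /\ B i (inner y x)]).
      exact: bU.
    apply/seteqP; split => y /=; first by move=> [hy [i _ By]]; exists i.
    by move=> [i _ [hy By]]; split => //; exists i.
suff : (measurable : set (set R)) `<=` G by apply.
have -> : (measurable : set (set R)) = <<s @RGenOInfty.G R >>.
  exact: RGenOInfty.measurableE.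
apply: smallest_sub => // _ [c ->].
apply: sub_sigma_algebra.
have := openL2_inner c hx; congr openL2.
by apply/seteqP; split => y /=; rewrite in_itv/= andbT.
Qed.

Context {dO : measure_display} {Omega : measurableType dO}.
Variables (P : probability Omega R) (Ft : R -> set (set Omega)).
Hypothesis hFt : filtration Ft.

(** Stated on the type carrying the sigma-algebra generated by [Ft t], so that
    sums, products and implicit functions of adapted variables are handled by
    the general theory of measurable functions. *)
Definition adapted (t : R) (X : Omega -> R) : Prop :=
  measurable_fun (setT : set (g_sigma_algebraType (Ft t))) X.

Lemma measurable_Ft t (B : set Omega) : 0 <= t ->
  measurable (B : set (g_sigma_algebraType (Ft t))) <-> Ft t B.
Proof.
move=> t0; have [/(_ _ t0) sF _ _] := hFt.
by split=> [|FB]; [exact: smallest_sub|exact: (@sub_sigma_algebra _ setT (Ft t) B FB)].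
Qed.

Lemma adapted_preimage t X (B : set R) : 0 <= t -> adapted t X -> measurable B ->
  Ft t (X @^-1` B).
Proof.
move=> t0 aX mB; apply: (iffLR (measurable_Ft _ t0)).
by rewrite -[X in measurable X]setTI; exact: aX.
Qed.

Lemma adaptedP t X : 0 <= t -> (forall B, measurable B -> Ft t (X @^-1` B)) ->
  adapted t X.
Proof.
move=> t0 FX _ B mB; rewrite setTI.
by apply: (iffRL (measurable_Ft _ t0)); exact: FX.
Qed.

Lemma adapted_mono s t X : 0 <= s -> s <= t -> adapted s X -> adapted t X.
Proof.
move=> s0 st aX; have t0 := le_trans s0 st; apply: adaptedP => // B mB.
by have [_ _ mono] := hFt; apply: (mono _ _ s0 st); exact: adapted_preimage.
Qed.

Lemma adapted_measurable t X : 0 <= t -> adapted t X -> measurable_fun setT X.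
Proof.
move=> t0 aX _ B mB; rewrite setTI; have [_ /(_ _ t0) sub _] := hFt.
by apply: sub; exact: adapted_preimage.
Qed.

Variables (Q : fn -> fn) (W : R -> Omega -> fn).
Hypothesis hW : Q_wiener P Ft Q W.

Lemma adapted_wiener t (x : fn) : 0 <= t -> inL 2 x ->
  adapted t (fun w => inner (W t w) x).
Proof.
move=> t0 hx; apply: adaptedP => // B mB.
have := wiener_adapted hW t0 (borelL2_inner hx mB); congr (Ft t).
apply/seteqP; split => w /=; first by case.
by move=> Bw; split => //; exact: (wiener_L2 hW).
Qed.

Variables (s t : R) (x : fn).
Hypotheses (s_ge0 : 0 <= s) (lt_st : s < t) (hx : inL 2 x).
Let dW (w : Omega) : R := inner (fun z => W t w z - W s w z) x.
Let t_ge0 : 0 <= t. Proof. by rewrite (le_trans s_ge0)// ltW. Qed.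
Let le_st : s <= t. Proof. exact: ltW. Qed.
Let inc_inL w : inL 2 (fun z => W t w z - W s w z).
Proof. by apply: inL2B; exact: (wiener_L2 hW). Qed.

Lemma adapted_increment : adapted t dW.
Proof.
have -> : dW = (fun w => inner (W t w) x - inner (W s w) x).
  by apply/funext => w; rewrite /dW innerBl//; exact: (wiener_L2 hW).
apply: measurable_funB; first exact: adapted_wiener.
by apply: (adapted_mono s_ge0 le_st); exact: adapted_wiener.
Qed.

Lemma increment_independent X A B : adapted s X -> measurable A -> measurable B ->
  P (X @^-1` A `&` dW @^-1` B) = (P (X @^-1` A) * P (dW @^-1` B))%E.
Proof.
move=> aX mA mB.
have E : dW @^-1` B = (fun w z => W t w z - W s w z) @^-1`
    [set y | inL 2 y /\ B (inner y x)].
  apply/seteqP; split => w /=; first by move=> Bw; split => //; exact: inc_inL.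
  by case.
rewrite E; apply: (wiener_independent hW s_ge0 le_st); last exact: borelL2_inner.
exact: adapted_preimage.
Qed.

Hypothesis hQ : bounded_operator Q.

(** This is the Gaussian law of the increment tested against [- x], for which
    the quadratic form of [Q] takes the same value. *)
Lemma gaussian_increment_opp :
  gaussian P (fun w => - dW w) 0 ((t - s) * inner (Q x) x).
Proof.
have [Qin Qlin _] := hQ.
(* Linearity of [Q] is available for [a * x + y] only, hence [- x] is written
   as [-2 * x + x]. *)
have NxE : (fun z => -2 * x z + x z) = (fun z => -1 * x z).
  by apply/funext => z; ring.
have hNx : inL 2 (fun z => -1 * x z) by exact: inL2Z.
have := wiener_gaussian hW s_ge0 le_st hNx.
have -> : (fun w => inner (fun z => W t w z - W s w z) (fun z => -1 * x z)) =
          (fun w => - dW w).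
  apply/funext => w; rewrite innerC innerZl//.
  by rewrite innerC mulN1r.
have -> // : inner (Q (fun z => -1 * x z)) (fun z => -1 * x z) = inner (Q x) x.
have hQx := Qin _ hx.
transitivity (inner (fun z => -1 * Q x z) (fun z => -1 * x z)).
  apply: inner_ae; try by apply: (@inL_measurable _ _ 2).
  - by apply: (@inL_measurable _ _ 2); exact: Qin.
  - by apply: (@inL_measurable _ _ 2); exact: inL2Z.
  - have := Qlin (-2) x x hx hx; rewrite NxE; apply: filterS => z /= /(_ I) -> _.
    by ring.
by rewrite innerZl// innerC innerZl// innerC; ring.
Qed.

Hypothesis Qx_gt0 : 0 < inner (Q x) x.

Let var_gt0 : 0 < (t - s) * inner (Q x) x.
Proof. by rewrite mulr_gt0 ?subr_gt0. Qed.

Lemma increment_measurable : measurable_fun setT dW.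
Proof. exact: adapted_measurable t_ge0 adapted_increment. Qed.

Lemma increment_sqr : (\int[P]_w (dW w ^+ 2)%:E = ((t - s) * inner (Q x) x)%:E)%E.
Proof.
apply: gaussian_sqr => //; first exact: increment_measurable.
exact: (wiener_gaussian hW s_ge0 le_st hx).
Qed.

Lemma increment_Lfun2 : dW \in Lfun P 2%:E.
Proof.
apply: sqr_integrable_Lfun2; first exact: increment_measurable.
by rewrite increment_sqr ltry.
Qed.

Lemma increment_Lfun1 : dW \in Lfun P 1%E.
Proof. by apply: Lfun_subset12; [rewrite fin_num_measure|exact: increment_Lfun2]. Qed.

Lemma increment_mean0 : (\int[P]_w (dW w)%:E = 0)%E.
Proof.
apply: (gaussian_mean0 increment_measurable increment_Lfun1).
  exact: (wiener_gaussian hW s_ge0 le_st hx).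
exact: gaussian_increment_opp.
Qed.

Lemma increment_orthogonal X : adapted s X -> X \in Lfun P 2%:E ->
  (\int[P]_w (X w * dW w)%:E = 0)%E.
Proof.
move=> aX X2; apply: independent_mean0.
- exact: adapted_measurable s_ge0 aX.
- exact: increment_measurable.
- by move=> A B mA mB; exact: increment_independent.
- by apply: Lfun2_mul_Lfun1 => //; exact: increment_Lfun2.
- exact: increment_Lfun1.
- exact: increment_mean0.
Qed.

End wiener_increments.

(** * The implicit step depends measurably on the data *)

Section avf_measurability.
Context {R : realType} {d : nat} {lam : nat -> R} {e : nat -> 'rV[R]_d -> R}.
Local Notation mu := (cubeL R d).
Local Notation fn := ('rV[R]_d -> R).
Hypothesis he : dirichlet_eigenbasis lam e.
Variables (c3 c2 c1 c0 : R).
Local Notation f := (cubic c3 c2 c1 c0).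
Variables (N : nat) (h : R).
Hypothesis h_gt0 : 0 < h.

Let avg := (@average_coord R d e c3 c2 c1 c0 N).

Definition avf_velocity (p q y : 'rV[R]_N) : 'rV[R]_N :=
  \row_i (2 / h * (y ord0 i - p ord0 i) - q ord0 i).

Definition avf_residual (p q y : 'rV[R]_N) (i : 'I_N) : R :=
  2 / h * (y ord0 i - p ord0 i) - q ord0 i
  - (q ord0 i - h * (lam i * ((p ord0 i + y ord0 i) / 2)) - h * avg p y i).

(** Eliminating the velocity with [avf_velocity] leaves the new position as the
    only unknown, and turns the step into the search for a zero of this sum of
    squares. *)
Definition avf_defect (p q y : 'rV[R]_N) : R := \sum_(i < N) avf_residual p q y i ^+ 2.

Lemma avf_coords_velocity (p q y qb : 'rV[R]_N) :
  avf_coords (lam := lam) (e := e) c3 c2 c1 c0 h p q y qb -> qb = avf_velocity p q y.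
Proof.
move=> H; apply/rowP => i; rewrite mxE (H i).1.
by field; rewrite gt_eqF.
Qed.

Lemma avf_defect_eq0 (p q y : 'rV[R]_N) : avf_defect p q y = 0 <->
  avf_coords (lam := lam) (e := e) c3 c2 c1 c0 h p q y (avf_velocity p q y).
Proof.
split=> [/eqP|H].
  rewrite psumr_eq0 => [/allP H i|i _]; last exact: sqr_ge0.
  have := H i (mem_index_enum _); rewrite /= sqrf_eq0 subr_eq0 => /eqP E.
  by rewrite mxE; split; [field; rewrite gt_eqF|exact: E].
rewrite /avf_defect big1// => i _; have := (H i).2; rewrite mxE /avf_residual => ->.
by rewrite subrr expr0n.
Qed.

(** The class [C] stands for the measurable functions of the data, at a fixed
    candidate [y], and for the continuous functions of the candidate, at fixed
    data. *)
Section class.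
Context {X : Type} (C : (X -> R) -> Prop).
Hypothesis C_cst : forall c, C (fun=> c).
Hypothesis C_add : forall a b, C a -> C b -> C (fun x => a x + b x).
Hypothesis C_mul : forall a b, C a -> C b -> C (fun x => a x * b x).
Variables p q y : X -> 'rV[R]_N.
Hypothesis Cp : forall i, C (fun x => p x ord0 i).
Hypothesis Cq : forall i, C (fun x => q x ord0 i).
Hypothesis Cy : forall i, C (fun x => y x ord0 i).

Let C_sub a b : C a -> C b -> C (fun x => a x - b x).
Proof.
move=> Ca Cb; rewrite (_ : (fun x => _) = (fun x => a x + -1 * b x)).
  by apply: C_add => //; exact: C_mul.
by apply/funext => x; rewrite mulN1r.
Qed.

Let C_sum n (a : 'I_n -> X -> R) : (forall i, C (a i)) -> C (fun x => \sum_(i < n) a i x).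
Proof.
elim: n a => [|n IH] a Ca.
  by rewrite (_ : (fun x => _) = (fun=> 0)) //; apply/funext => x; rewrite big_ord0.
rewrite (_ : (fun x => _) = (fun x => a ord0 x + \sum_(i < n) a (lift ord0 i) x)).
  by apply: C_add => //; apply: IH.
by apply/funext => x; rewrite big_ord_recl.
Qed.

Lemma finite_rank_comb (r : X -> 'rV[R]_N) : (forall i, C (fun x => r x ord0 i)) ->
  finite_rank C (fun x => comb e (r x)).
Proof.
move=> Cr; rewrite /comb; apply: finite_rank_sum => // i.
by apply: finite_rank_tensor => //; exact: eigen_essbdd he i.
Qed.

Lemma average_coord_class i : C (fun x => avg (p x) (y x) i).
Proof.
apply: finite_rank_integral => //; apply: finite_rankM => //.
  by apply: finite_rank_average => //; exact: finite_rank_comb.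
rewrite (_ : (fun _ => e i) = (fun (_ : X) z => 1 * e i z)).
  by apply: finite_rank_tensor => //; exact: eigen_essbdd he i.
by apply/funext => x; apply/funext => z; rewrite mul1r.
Qed.

Lemma avf_defect_class : C (fun x => avf_defect (p x) (q x) (y x)).
Proof.
have Ca := average_coord_class.
apply: C_sum => i; rewrite /avf_residual.
under eq_fun do rewrite expr2.
by apply: C_mul; repeat first [exact: C_cst | exact: Cp | exact: Cq | exact: Cy
  | exact: Ca | apply: C_sub | apply: C_add | apply: C_mul].
Qed.

End class.

Variable hbar : R.
Hypothesis hsolv : avf_solvable e f hbar.
Hypothesis N_gt0 : (0 < N)%N.
Hypothesis hh : h <= hbar.

Lemma avf_measurable {dT} {T : measurableType dT} (p q y qb : T -> 'rV[R]_N) :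
  (forall i, measurable_fun setT (fun t => p t ord0 i)) ->
  (forall i, measurable_fun setT (fun t => q t ord0 i)) ->
  (forall t, avf_coords (lam := lam) (e := e) c3 c2 c1 c0 h (p t) (q t) (y t) (qb t)) ->
  forall i, measurable_fun setT (fun t => y t ord0 i) /\
            measurable_fun setT (fun t => qb t ord0 i).
Proof.
move=> mp mq H.
have my i : measurable_fun setT (fun t => y t ord0 i).
  apply: (@measurable_unique_zero _ _ _ _ (fun t z => avf_defect (p t) (q t) z)).
  - by move=> t z; apply: sumr_ge0 => j _; exact: sqr_ge0.
  - move=> z; apply: (@avf_defect_class _ (@measurable_fun _ _ T R setT) _ _ _ p q (fun=> z)) => //.
    + by move=> a b; exact: measurable_funD.
    + by move=> a b; exact: measurable_funM.
  - move=> t.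
    apply: (@avf_defect_class _ (fun a : 'rV[R]_N -> R => continuous a) _ _ _ (fun=> p t) (fun=> q t) id).
    + by move=> c; exact: cst_continuous.
    + by move=> a b ca cb z; apply: continuousD; [exact: ca|exact: cb].
    + by move=> a b ca cb z; apply: continuousM; [exact: ca|exact: cb].
    + by move=> j; exact: cst_continuous.
    + by move=> j; exact: cst_continuous.
    + by move=> j z; exact: coord_continuous.
  - move=> t z; split => [/avf_defect_eq0 Hz|->].
      exact: (avf_coords_unique he hsolv N_gt0 h_gt0 hh Hz (H t)).
    by apply/avf_defect_eq0; rewrite -(avf_coords_velocity (H t)).
move=> i; split; first exact: my.
rewrite (_ : (fun t => _) =
    (fun t => 2 / h * (y t ord0 i - p t ord0 i) - q t ord0 i)); last first.
  by apply/funext => t; rewrite (avf_coords_velocity (H t)) mxE.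
apply: measurable_funB => //; apply: measurable_funM => //.
exact: measurable_funB.
Qed.

End avf_measurability.

(** * The scheme *)

Section scheme.
Context {R : realType} {d : nat} {lam : nat -> R} {e : nat -> 'rV[R]_d -> R}.
Local Notation mu := (cubeL R d).
Local Notation fn := ('rV[R]_d -> R).
Hypothesis he : dirichlet_eigenbasis lam e.
Context {dO : measure_display} {Omega : measurableType dO}.
Variables (P : probability Omega R) (Ft : R -> set (set Omega)).
Hypothesis hFt : filtration Ft.
Variables (Q : fn -> fn) (W : R -> Omega -> fn).
Hypotheses (hQ : bounded_operator Q) (hQpos : positive_definite Q).
Hypothesis hW : Q_wiener P Ft Q W.
Variables (c3 c2 c1 c0 : R) (F : fn -> R).
Local Notation f := (cubic c3 c2 c1 c0).
Hypothesis hF : potential f F.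
Variables (b1 C1 : R).
Hypothesis F_ge : forall x : fn, inL 4 x -> - b1 <= F x.
Hypothesis hC1 : b1 < C1.
Variable hbar : R.
Hypothesis hsolv : avf_solvable e f hbar.
Variables (N M : nat) (h : R).
Hypotheses (N_gt0 : (0 < N)%N) (h_gt0 : 0 < h) (hh : h <= hbar).
Variables (u0 v0 : fn) (u v vbar : nat -> Omega -> fn).
Hypothesis huv : avf_solution e f N M h W u0 v0 u v vbar.

Let eigen_inL i : inL 2 (e i). Proof. exact: (eigen_inL he). Qed.
Let comb_inL n (p : 'rV[R]_n) : inL 2 (comb e p). Proof. exact: (comb_inL he). Qed.
Hint Resolve eigen_inL comb_inL : core.

Let t_ (m : nat) : R := m%:R * h.
Let t_ge0 m : 0 <= t_ m. Proof. by rewrite mulr_ge0// ltW. Qed.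
Let t_lt m : t_ m < t_ m.+1. Proof. by rewrite /t_ ltr_pM2r// ltr_nat. Qed.
Let t_step m : t_ m.+1 - t_ m = h. Proof. by rewrite /t_ -mulrBl -natrB// subSnn mul1r. Qed.

Let p m w : 'rV[R]_N := coords e N (u m w).
Let q m w : 'rV[R]_N := coords e N (v m w).
Let qb m w : 'rV[R]_N := coords e N (vbar m w).
Let dW m w : fn := fun z => W (t_ m.+1) w z - W (t_ m) w z.
Let Y m (i : 'I_N) w : R := inner (dW m w) (e i).

Lemma solution_start w : p 0%N w = coords e N u0 /\ q 0%N w = coords e N v0.
Proof.
have [hL up vp _] := huv w; have [hu hv] := hL 0%N isT.
by split; apply: (coords_eq he) => //; rewrite -projN_comb.
Qed.

Lemma solution_step m w : (m < M)%N ->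
  u m w = comb e (p m w) %[ae mu] -> v m w = comb e (q m w) %[ae mu] ->
  [/\ u m.+1 w = comb e (p m.+1 w) %[ae mu], v m.+1 w = comb e (q m.+1 w) %[ae mu],
      avf_coords (lam := lam) (e := e) c3 c2 c1 c0 h (p m w) (q m w)
        (p m.+1 w) (qb m.+1 w) &
      forall i, q m.+1 w ord0 i = qb m.+1 w ord0 i + Y m i w].
Proof.
move=> mM up vq; have [hL _ _ /(_ m mM)[hstep hv]] := huv w.
have [hu _] := hL m (ltnW mM); have [_ hv'] := hL m.+1 mM.
have [up' vbq H] := avf_stepP he hu up vq hstep.
have vq' : v m.+1 w = comb e (qb m.+1 w + 1 *: coords e N (dW m w)) %[ae mu].
  apply: ae_eq_trans hv _; apply: filterS vbq => z /= + _ => /(_ I) ->.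
  by rewrite comb_lin mul1r -(projN_comb N (dW m w)).
have E := coords_eq he hv' vq'.
split => //; first by rewrite /q E.
by move=> i; rewrite /q E !mxE mul1r.
Qed.

Lemma solution_comb m w : (m <= M)%N ->
  u m w = comb e (p m w) %[ae mu] /\ v m w = comb e (q m w) %[ae mu].
Proof.
elim: m => [_|m IH mM]; last by have [up vq] := IH (ltnW mM); have [] := solution_step mM up vq.
have [_ up vq _] := huv w; have [-> ->] := solution_start w.
by rewrite -!projN_comb.
Qed.

Lemma solution_coords m w : (m < M)%N ->
  avf_coords (lam := lam) (e := e) c3 c2 c1 c0 h (p m w) (q m w)
    (p m.+1 w) (qb m.+1 w) /\
  forall i, q m.+1 w ord0 i = qb m.+1 w ord0 i + Y m i w.
Proof.
by move=> mM; have [up vq] := solution_comb w (ltnW mM); have [] := solution_step mM up vq.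
Qed.

(** The noise of the step is added last, so the new position and the
    intermediate velocity are still known at the beginning of the step. *)
Lemma solution_adapted_next m : (m < M)%N ->
  (forall i, adapted Ft (t_ m) (fun w => p m w ord0 i) /\
             adapted Ft (t_ m) (fun w => q m w ord0 i)) ->
  forall i, adapted Ft (t_ m) (fun w => p m.+1 w ord0 i) /\
            adapted Ft (t_ m) (fun w => qb m.+1 w ord0 i).
Proof.
move=> mM ad; apply: (avf_measurable he h_gt0 hsolv N_gt0 hh
    (T := g_sigma_algebraType (Ft (t_ m))) (p := p m) (q := q m)).
- by move=> i; have [] := ad i.
- by move=> i; have [] := ad i.
- by move=> w; have [] := solution_coords w mM.
Qed.

Lemma solution_adapted m : (m <= M)%N ->
  forall i, adapted Ft (t_ m) (fun w => p m w ord0 i) /\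
            adapted Ft (t_ m) (fun w => q m w ord0 i).
Proof.
elim: m => [_ i|m IH mM i].
  have -> : (fun w => p 0%N w ord0 i) = (fun=> coords e N u0 ord0 i).
    by apply/funext => w; rewrite (solution_start w).1.
  have -> : (fun w => q 0%N w ord0 i) = (fun=> coords e N v0 ord0 i).
    by apply/funext => w; rewrite (solution_start w).2.
  by split; exact: measurable_cst.
have [ap aqb] := solution_adapted_next mM (IH (ltnW mM)) i.
have up X : adapted Ft (t_ m) X -> adapted Ft (t_ m.+1) X.
  exact: (adapted_mono hFt (t_ge0 m) (ltW (t_lt m))).
split; first exact: up.
have -> : (fun w => q m.+1 w ord0 i) = (fun w => qb m.+1 w ord0 i + Y m i w).
  by apply/funext => w; have [_ ->] := solution_coords w mM.
apply: measurable_funD; first exact: up.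
exact: (adapted_increment hFt hW (t_ge0 m) (t_lt m) (eigen_inL i)).
Qed.

Let V := V1 lam e F C1.
Let En m w : R := V (comb e (p m w)) (comb e (q m w)).

Lemma energy_coords m w : (m <= M)%N -> V (u m w) (v m w) = En m w.
Proof.
move=> mM; have [up vq] := solution_comb w mM; have [hL _ _ _] := huv w.
by have [hu hv] := hL m mM; exact: (V1_ae he C1 hF hu hv up vq).
Qed.

(** [F] is at least [- b1] and [C1] exceeds [b1], so every part of [V1] but the
    kinetic energy can be dropped. *)
Lemma V1_ge_velocity (a b : 'rV[R]_N) i : b ord0 i ^+ 2 <= 2 * V (comb e a) (comb e b).
Proof.
rewrite /V (V1_comb he).
have Fa : - b1 <= F (comb e a).
  by apply: F_ge; apply: essbdd_inL; [rewrite ler1n|exact: (comb_essbdd he)].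
have s1 : 0 <= \sum_(j < N) lam j * a ord0 j ^+ 2.
  apply: sumr_ge0 => j _; rewrite mulr_ge0 ?sqr_ge0// ltW//.
  exact: (eigenvalue_gt0 he).
have s2 : b ord0 i ^+ 2 <= \sum_(j < N) b ord0 j ^+ 2.
  by rewrite (bigD1 i)//= lerDl; apply: sumr_ge0 => j _; exact: sqr_ge0.
by have := hC1; lra.
Qed.

Lemma energy_step m w : (m < M)%N ->
  En m.+1 w = En m w + \sum_(i < N) (qb m.+1 w ord0 i * Y m i w + 2^-1 * Y m i w ^+ 2).
Proof.
move=> mM; have [H Hq] := solution_coords w mM.
rewrite /En /V -(avf_energy he C1 hF H) !(V1_comb he).
have -> : \sum_(i < N) q m.+1 w ord0 i ^+ 2 =
   \sum_(i < N) qb m.+1 w ord0 i ^+ 2 +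
   2 * \sum_(i < N) (qb m.+1 w ord0 i * Y m i w + 2^-1 * Y m i w ^+ 2).
  by rewrite mulr_sumr -big_split/=; apply: eq_bigr => i _; rewrite Hq; field.
by field.
Qed.

Lemma qb_sqr_le m w i : (m < M)%N -> qb m.+1 w ord0 i ^+ 2 <= 2 * En m w.
Proof.
move=> mM; have [H _] := solution_coords w mM.
by rewrite /En /V -(avf_energy he C1 hF H); exact: V1_ge_velocity.
Qed.

Lemma Q_eigen_gt0 i : 0 < inner (Q (e i)) (e i).
Proof.
apply: hQpos => // e0; have := eigen_inner he i i; rewrite eqxx => /eqP.
rewrite (@inner_ae _ _ _ (fun=> 0))//; try exact: inL_measurable (eigen_inL i).
rewrite /inner; under eq_Rintegral do rewrite mul0r.
by rewrite /Rintegral integral0 eq_sym oner_eq0.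
Qed.

(** The cross terms are orthogonal by [increment_orthogonal], which requires the
    square integrability of [qb]; that in turn follows from the integrability
    of the energy of the previous step, provided by the induction. *)
Lemma expected_energy m : (m <= M)%N ->
  En m \in Lfun P 1%E /\
  (\int[P]_w (En m w)%:E = (V (comb e (coords e N u0)) (comb e (coords e N v0)) +
     2^-1 * (\sum_(i < N) inner (Q (e i)) (e i)) * t_ m)%:E)%E.
Proof.
elim: m => [_|m IH mM].
  have -> : En 0%N = (fun=> V (comb e (coords e N u0)) (comb e (coords e N v0))).
    by apply/funext => w; rewrite /En; have [-> ->] := solution_start w.
  split; first exact: Lfun_cst.
  rewrite integral_cst//; set a := V _ _.
  transitivity (a%:E * 1)%E; first by congr (_ * _)%E; exact: probability_setT.
  by rewrite mule1 /t_ mul0r mulr0 addr0.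
have [/Lfun1_integrable iE EE] := IH (ltnW mM).
have aqb i := (solution_adapted_next mM (solution_adapted (ltnW mM)) i).2.
have Y2 i : Y m i \in Lfun P 2%:E.
  exact: (increment_Lfun2 hFt hW (t_ge0 m) (t_lt m) (eigen_inL i) (Q_eigen_gt0 i)).
have qb2 i : (fun w => qb m.+1 w ord0 i) \in Lfun P 2%:E.
  have mqb := adapted_measurable hFt (t_ge0 m) (aqb i).
  apply: sqr_integrable_Lfun2 => //.
  apply: (@le_lt_trans _ _ (\int[P]_w (2%:E * (En m w)%:E))%E).
    apply: ge0_le_integral => //.
    - by move=> w _; rewrite lee_fin sqr_ge0.
    - by apply/measurable_EFinP; exact: measurable_funX.
    - by apply: measurable_funeM; exact: measurable_int iE.
    - by move=> w _; rewrite -EFinM lee_fin qb_sqr_le.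
  by rewrite integralZl// EE -EFinM ltry.
have iqY i : P.-integrable setT (fun w => (qb m.+1 w ord0 i * Y m i w)%:E).
  by apply/Lfun1_integrable; exact: Lfun2_mul_Lfun1.
have iY2 i : P.-integrable setT (fun w => (2^-1 * Y m i w ^+ 2)%:E).
  have := integrableZl measurableT (2^-1) (Lfun2_integrable_sqr (Y2 i)).
  by apply: eq_integrable.
have isum i : P.-integrable setT
    (fun w => (qb m.+1 w ord0 i * Y m i w + 2^-1 * Y m i w ^+ 2)%:E).
  by have := integrableD measurableT (iqY i) (iY2 i); exact: eq_integrable.
have Isum i : (\int[P]_w (qb m.+1 w ord0 i * Y m i w + 2^-1 * Y m i w ^+ 2)%:E =
    (2^-1 * (h * inner (Q (e i)) (e i)))%:E)%E.
  under eq_integral do rewrite EFinD.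
  rewrite integralD//.
  rewrite (increment_orthogonal hFt hW (t_ge0 m) (t_lt m) (eigen_inL i) hQ
    (Q_eigen_gt0 i) (aqb i) (qb2 i)) add0e.
  under eq_integral do rewrite EFinM.
  rewrite integralZl//; last exact: Lfun2_integrable_sqr (Y2 i).
  rewrite (increment_sqr hFt hW (t_ge0 m) (t_lt m) (eigen_inL i) (Q_eigen_gt0 i)).
  by rewrite t_step EFinM.
have EnS w : ((En m.+1 w)%:E = (En m w)%:E +
    \sum_(i < N) (qb m.+1 w ord0 i * Y m i w + 2^-1 * Y m i w ^+ 2)%:E)%E.
  by rewrite energy_step// EFinD sumEFin.
have isums : P.-integrable setT (fun w =>
    \sum_(i < N) (qb m.+1 w ord0 i * Y m i w + 2^-1 * Y m i w ^+ 2)%:E)%E.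
  by apply: integrable_sum.
split.
  apply/Lfun1_integrable; have := integrableD measurableT iE isums.
  by apply: eq_integrable => // w _; rewrite /= EnS.
rewrite (eq_integral _ _ (fun w _ => EnS w)).
rewrite integralD// EE integral_sum//.
rewrite (eq_bigr _ (fun i _ => Isum i)).
rewrite sumEFin -EFinD; congr EFin.
rewrite -!mulr_sumr /t_ -natr1; ring.
Qed.

End scheme.

Theorem theorem4p1 (R : realType) (d : nat) (hd : d = 1%N \/ d = 2%N)
    (lam : nat -> R) (e : nat -> 'rV[R]_d -> R)
    (he : dirichlet_eigenbasis lam e)
    (dO : measure_display) (Omega : measurableType dO)
    (P : probability Omega R)
    (Ft : R -> set (set Omega)) (hFt : filtration Ft)
    (Q S : ('rV[R]_d -> R) -> 'rV[R]_d -> R)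
    (hQ : bounded_operator Q) (hQsym : symmetric_operator Q)
    (hQpos : positive_definite Q) (hQtr : finite_trace e Q)
    (W : R -> Omega -> 'rV[R]_d -> R) (hW : Q_wiener P Ft Q W)
    (c3 c2 c1 c0 : R) (hc3 : 0 < c3)
    (F : ('rV[R]_d -> R) -> R) (hF : potential (cubic c3 c2 c1 c0) F)
    (a1 a2 b1 b2 : R) (ha1 : 0 < a1) (ha2 : 0 < a2)
    (hb1 : 0 < b1) (hb2 : 0 < b2)
    (hFbound : forall u : 'rV[R]_d -> R, inL 4 u ->
       a1 * normL 4 u ^+ 4 - b1 <= F u <= a2 * normL 4 u ^+ 4 + b2)
    (hbar0 : R) (hhbar0 : 0 < hbar0)
    (hsolv : avf_solvable e (cubic c3 c2 c1 c0) hbar0)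
    (T : R) (hT : 0 < T) (u0 v0 : 'rV[R]_d -> R)
    (hu0 : in_Hdot lam e 1 u0) (hv0 : in_Hdot lam e 0 v0)
    (hS : is_sqrt_operator Q S) (hSHS : hilbert_schmidt e S)
    (N M : nat) (hN : (0 < N)%N) (hM : (0 < M)%N)
    (h : R) (hMh : M%:R * h = T) (hh : h <= hbar0)
    (u v vbar : nat -> Omega -> 'rV[R]_d -> R)
    (huv : avf_solution e (cubic c3 c2 c1 c0) N M h W u0 v0 u v vbar)
    (C1 : R) (hC1 : b1 < C1)
    (m : nat) (hm : (m <= M)%N) :
  let A := fun x => projN e N (S x) in
  (fun w => V1 lam e F C1 (u m w) (v m w)) \in Lfun P 1%E /\
  ('E_P[fun w => V1 lam e F C1 (u m w) (v m w)])%E =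
    (V1 lam e F C1 (projN e N u0) (projN e N v0)
     + 2^-1 * trace e (fun x => A (adjoint A x)) * (m%:R * h))%:E.
Proof.
move=> A.
have h_gt0 : 0 < h by rewrite -(@pmulr_rgt0 _ M%:R) ?ltr0n// hMh.
have F_ge (x : 'rV[R]_d -> R) : inL 4 x -> - b1 <= F x.
  move=> hx; have /andP[+ _] := hFbound x hx; apply: le_trans.
  by rewrite lerDr mulr_ge0 ?exprn_ge0 ?normL_ge0// ltW.
have VE w := energy_coords he hF C1 huv w hm.
have -> : (fun w => V1 lam e F C1 (u m w) (v m w)) =
    (fun w => V1 lam e F C1 (comb e (coords e N (u m w))) (comb e (coords e N (v m w)))).
  by apply/funext => w; exact: VE.
have [iE EE] := expected_energy he hFt hQ hQpos hW hF F_ge hC1 hsolv hN h_gt0 hh huv hm.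
split; first exact: iE.
by rewrite unlock EE (trace_projection he N hS hQ) !projN_comb.
Qed.
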